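(* There exist a stable 2-coloring of pairs $f:[\omega]^2\to 2$ and a family $Y$ of infinite subsets of $\omega$ such that (i) for every $P\in Y$, no $(f\oplus P)$-computable set is p-homogeneous for $f$; and (ii) every stable 2-coloring of pairs $f':[\omega]^2\to 2$ with $f'\le_T f$ either has an $(f\oplus P)$-computable increasing p-homogeneous set for some $P\in Y$, or else has some increasing p-homogeneous set which computes no set p-homogeneous for $f$.
   Context: A 2-coloring of pairs is $f:[\omega]^2\to 2$, with $f(x,y)$ meaning $f(\{x,y\})$ for $x<y$; it is stable if $\lim_u f(x,u)$ exists for all $x$. $A\oplus B=\{2x:x\in A\}\cup\{2y+1:y\in B\}$. A set $H=H_L\oplus H_R$ with $H_L,H_R$ infinite is p-homogeneous for a coloring $g$ if $g(\{x,y\})$ is constant over $x\in H_L$, $y\in H_R$, $x\neq y$; it is increasing p-homogeneous for $g$ if $g(x,y)$ is constant over $x\in H_L$, $y\in H_R$, $x<y$. *)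

(* Defs.v *)
(* Oracle computability via mu-recursive functions with an
   oracle, sets as characteristic functions nat -> bool, 2-colorings of
   pairs as functions nat -> nat -> bool (only the values f x y with x < y
   are meaningful: f(x,y) = f({x,y}) for x < y). *)
From Stdlib Require Import Arith List Cantor.
Import ListNotations.

Definition set := nat -> bool.
Definition coloring := nat -> nat -> bool.

Inductive prog : Type :=
| PZero : prog
| PSucc : prog
| PProj : nat -> prog
| POracle : prog
| PComp : prog -> list prog -> prog
| PRec : prog -> prog -> prog
| PMu : prog -> prog.

Inductive eval (A : set) : prog -> list nat -> nat -> Prop :=
| ev_zero : forall args, eval A PZero args 0
| ev_succ : forall x args, eval A PSucc (x :: args) (S x)
| ev_proj : forall i args, i < length args -> eval A (PProj i) args (nth i args 0)
| ev_oracle : forall x args,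
    eval A POracle (x :: args) (if A x then 1 else 0)
| ev_comp : forall f gs args vs r,
    eval_list A gs args vs -> eval A f vs r -> eval A (PComp f gs) args r
| ev_rec0 : forall g h args r,
    eval A g args r -> eval A (PRec g h) (0 :: args) r
| ev_recS : forall g h n args r r',
    eval A (PRec g h) (n :: args) r ->
    eval A h (n :: r :: args) r' ->
    eval A (PRec g h) (S n :: args) r'
| ev_mu : forall f args n,
    eval A f (n :: args) 0 ->
    (forall m, m < n -> exists k, eval A f (m :: args) (S k)) ->
    eval A (PMu f) args n
with eval_list (A : set) : list prog -> list nat -> list nat -> Prop :=
| evl_nil : forall args, eval_list A [] args []
| evl_cons : forall g gs args v vs,
    eval A g args v -> eval_list A gs args vs ->
    eval_list A (g :: gs) args (v :: vs).

Definition computable_from (A B : set) : Prop :=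
  exists p : prog, forall x, eval A p [x] (if B x then 1 else 0).

Definition Tred (B A : set) : Prop := computable_from A B.

Definition join (A B : set) : set :=
  fun n => if Nat.even n then A (Nat.div2 n) else B (Nat.div2 n).

Definition code (f : coloring) : set :=
  fun n => let (x, y) := Cantor.of_nat n in
           if x <? y then f x y else false.

Definition colpair (f : coloring) (x y : nat) : bool :=
  f (Nat.min x y) (Nat.max x y).

Definition infinite (A : set) : Prop :=
  forall n, exists m, n <= m /\ A m = true.

Definition stable (f : coloring) : Prop :=
  forall x, exists c N, forall u, N <= u -> x < u -> f x u = c.

Definition left_part (H : set) : set := fun x => H (2 * x).
Definition right_part (H : set) : set := fun y => H (2 * y + 1).

Definition p_homogeneous (g : coloring) (H : set) : Prop :=
  infinite (left_part H) /\ infinite (right_part H) /\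
  exists c, forall x y, left_part H x = true -> right_part H y = true ->
    x <> y -> colpair g x y = c.

Definition inc_p_homogeneous (g : coloring) (H : set) : Prop :=
  infinite (left_part H) /\ infinite (right_part H) /\
  exists c, forall x y, left_part H x = true -> right_part H y = true ->
    x < y -> g x y = c.

(* Main.v *)
(* We take Y empty. Let U be a nonprincipal ultrafilter on omega and let f be generic for finite
   conditions that also lock the limits of the numbers below their length; genericity is required
   for countably many families of conditions, some of them defined from U.

   Let f' <=_T f be stable. A solution H = L (+) R of color c is built by finite extensions, with
   L inside the set of numbers of f'-limit c. Given a functional G, either G can be kept from
   producing new outputs along U-many one-point extensions, or its outputs are unavoidable. In the
   second case we want outputs u in the left and v in the right part with f(u,v) <> lim f(u,-),
   or with u and v of different limits. Both colors c = 0, 1 are played simultaneously. What has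
   been achieved is only promised recurrently: the locks may be broken, provided that they can be
   restored later. When a side needs a new x in L, one x suitable for both sides is chosen, first
   the locks are violated on a block containing all the v that this x would determine, and then
   the promises are restored and the limit of x is decided; the side of that color advances. If
   instead v is determined by a new y in R, no limit has to be decided for y, so y can be taken
   after the locks are restored and v can be given the wrong limit. By well-founded induction one
   of the colors defeats G. By genericity this happens in f itself, so one of the colors defeats
   all functionals. *)
From mathcomp Require filter.
From Stdlib Require Import Arith List Cantor Lia Bool Classical ClassicalEpsilon.
From Stdlib Require Import FunctionalExtensionality.
Require Import Defs.
Import ListNotations.

(** * Oracle computations: finite use and determinism *)

Fixpoint eval_use A p args r (e : eval A p args r) {struct e} :
  exists N, forall B, (forall n, n < N -> A n = B n) -> eval B p args r
with eval_list_use A ps args vs (e : eval_list A ps args vs) {struct e} :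
  exists N, forall B, (forall n, n < N -> A n = B n) -> eval_list B ps args vs.
Proof.
- destruct e as [args|x args|i args Hi|x args|g gs args vs r e1 e2|g h args r e1
    |g h n args r r' e1 e2|g args n e1 H].
  + exists 0; intros; constructor.
  + exists 0; intros; constructor.
  + exists 0; intros; constructor; assumption.
  + exists (S x); intros B HB; rewrite (HB x) by lia; constructor.
  + destruct (eval_list_use _ _ _ _ e1) as [N1 H1], (eval_use _ _ _ _ e2) as [N2 H2].
    exists (Nat.max N1 N2); intros B HB; econstructor.
    * apply H1; intros; apply HB; lia.
    * apply H2; intros; apply HB; lia.
  + destruct (eval_use _ _ _ _ e1) as [N1 H1].
    exists N1; intros B HB; constructor; auto.
  + destruct (eval_use _ _ _ _ e1) as [N1 H1], (eval_use _ _ _ _ e2) as [N2 H2].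
    exists (Nat.max N1 N2); intros B HB; econstructor.
    * apply H1; intros; apply HB; lia.
    * apply H2; intros; apply HB; lia.
  + destruct (eval_use _ _ _ _ e1) as [N1 H1].
    (* Finitely many tests precede [n] in a [PMu] search; the induction on [k] takes the maximum of
       their uses. *)
    assert (Hb : forall k, k <= n -> exists N, forall B, (forall n, n < N -> A n = B n) ->
        forall m, m < k -> exists v, eval B g (m :: args) (S v)).
    { induction k as [|k IH]; intros Hk.
      - exists 0; intros B _ m Hm; lia.
      - destruct (IH ltac:(lia)) as [N HN].
        destruct (H k Hk) as [v ev].
        destruct (eval_use _ _ _ _ ev) as [N' HN'].
        exists (Nat.max N N'); intros B HB m Hm.
        destruct (Nat.eq_dec m k) as [->|].
        + exists v; apply HN'; intros; apply HB; lia.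
        + apply HN; [intros; apply HB; lia | lia]. }
    destruct (Hb n (le_n n)) as [N2 H2].
    exists (Nat.max N1 N2); intros B HB; constructor.
    * apply H1; intros; apply HB; lia.
    * apply H2; intros; apply HB; lia.
- destruct e as [args|g gs args v vs e1 e2].
  + exists 0; intros; constructor.
  + destruct (eval_use _ _ _ _ e1) as [N1 H1], (eval_list_use _ _ _ _ e2) as [N2 H2].
    exists (Nat.max N1 N2); intros B HB; constructor.
    * apply H1; intros; apply HB; lia.
    * apply H2; intros; apply HB; lia.
Qed.

Fixpoint eval_det A p args r (e : eval A p args r) {struct e} :
  forall r', eval A p args r' -> r = r'
with eval_list_det A ps args vs (e : eval_list A ps args vs) {struct e} :
  forall vs', eval_list A ps args vs' -> vs = vs'.
Proof.
- destruct e as [args|x args|i args Hi|x args|g gs args vs r e1 e2|g h args r e1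
    |g h n args r r' e1 e2|g args n e1 H]; intros r0 e0; inversion e0; subst; auto.
  + match goal with Hl : eval_list _ gs _ _, He : eval _ g _ _ |- _ =>
      rewrite <- (eval_list_det _ _ _ _ e1 _ Hl) in He; exact (eval_det _ _ _ _ e2 _ He) end.
  + match goal with He : eval _ g _ _ |- _ => exact (eval_det _ _ _ _ e1 _ He) end.
  + match goal with H1 : eval _ (PRec _ _) _ _, H2 : eval _ h _ _ |- _ =>
      rewrite <- (eval_det _ _ _ _ e1 _ H1) in H2; exact (eval_det _ _ _ _ e2 _ H2) end.
  + match goal with H1 : eval _ g _ 0, H2 : forall m, m < r0 -> _ |- _ =>
      destruct (Nat.lt_trichotomy n r0) as [Hlt|[->|Hlt]]; auto;
      [destruct (H2 n Hlt) as [k ek]; discriminate (eval_det _ _ _ _ e1 _ ek)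
      |destruct (H r0 Hlt) as [k ek]; discriminate (eval_det _ _ _ _ ek _ H1)] end.
- destruct e as [args|g gs args v vs e1 e2]; intros vs' e0; inversion e0; subst; auto.
  match goal with H1 : eval _ g _ _, H2 : eval_list _ gs _ _ |- _ =>
    rewrite <- (eval_det _ _ _ _ e1 _ H1), <- (eval_list_det _ _ _ _ e2 _ H2) end.
  reflexivity.
Qed.

(** * Countability of programs and of finite data *)

Fixpoint list_code (l : list nat) : nat :=
  match l with
  | [] => 0
  | x :: l => S (Cantor.to_nat (x, list_code l))
  end.

Lemma to_nat_inj_pair a b c d :
  Cantor.to_nat (a, b) = Cantor.to_nat (c, d) -> a = c /\ b = d.
Proof. intros H; apply Cantor.to_nat_inj in H; now injection H. Qed.

Lemma list_code_inj l l' : list_code l = list_code l' -> l = l'.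
Proof.
revert l'; induction l as [|x l IH]; intros [|y l']; simpl; try discriminate; auto.
intros H; injection H as H; apply to_nat_inj_pair in H as [-> H].
f_equal; auto.
Qed.

Fixpoint prog_code (p : prog) : nat :=
  match p with
  | PZero => Cantor.to_nat (0, 0)
  | PSucc => Cantor.to_nat (1, 0)
  | POracle => Cantor.to_nat (2, 0)
  | PProj i => Cantor.to_nat (3, i)
  | PComp g gs => Cantor.to_nat (4, Cantor.to_nat (prog_code g, list_code (map prog_code gs)))
  | PRec g h => Cantor.to_nat (5, Cantor.to_nat (prog_code g, prog_code h))
  | PMu g => Cantor.to_nat (6, prog_code g)
  end.

Fixpoint prog_code_inj (p q : prog) {struct p} : prog_code p = prog_code q -> p = q.
Proof.
destruct p, q; cbn [prog_code]; intros H; apply to_nat_inj_pair in H as [H1 H2];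
  try discriminate; try reflexivity.
- f_equal; exact H2.
- apply to_nat_inj_pair in H2 as [H2 H3]; f_equal.
  + now apply prog_code_inj.
  + apply list_code_inj in H3.
    (* The list induction is run inline so that the guard condition accepts the recursive calls on
       members of the list. *)
    clear H1 H2; revert l0 H3; induction l as [|x l IH]; intros [|y l']; simpl;
      try discriminate; auto.
    intros H; injection H as H H'; f_equal; [now apply prog_code_inj | auto].
- apply to_nat_inj_pair in H2 as [H2 H3]; f_equal; now apply prog_code_inj.
- f_equal; now apply prog_code_inj.
Qed.

Definition countable (T : Type) : Prop := exists g : T -> nat, forall x y, g x = g y -> x = y.

Lemma countable_nat : countable nat.
Proof. exists (fun n => n); auto. Qed.

Lemma countable_bool : countable bool.
Proof. exists Nat.b2n; intros [] []; simpl; congruence. Qed.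

Lemma countable_prog : countable prog.
Proof. exists prog_code; exact prog_code_inj. Qed.

Lemma countable_prod S T : countable S -> countable T -> countable (S * T).
Proof.
intros [g Hg] [h Hh]; exists (fun x => Cantor.to_nat (g (fst x), h (snd x))).
intros [a b] [c d] H; apply to_nat_inj_pair in H as [H1 H2]; simpl in *.
f_equal; auto.
Qed.

Lemma countable_sum S T : countable S -> countable T -> countable (S + T).
Proof.
intros [g Hg] [h Hh].
exists (fun x => match x with inl a => Cantor.to_nat (0, g a) | inr b => Cantor.to_nat (1, h b) end).
intros [a|b] [c|d] H; apply to_nat_inj_pair in H as [H1 H2]; try discriminate; f_equal; auto.
Qed.

Lemma countable_list T : countable T -> countable (list T).
Proof.
intros [g Hg]; exists (fun l => list_code (map g l)).
intros l l' H; apply list_code_inj in H; revert l' H.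
induction l as [|x l IH]; intros [|y l']; simpl; try discriminate; auto.
intros H; injection H as H H'; f_equal; auto.
Qed.

(** * Nonprincipal ultrafilters *)

Record ultrafilter (U : (nat -> Prop) -> Prop) : Prop := {
  uf_up : forall A B : nat -> Prop, U A -> (forall x, A x -> B x) -> U B;
  uf_and : forall A B : nat -> Prop, U A -> U B -> U (fun x => A x /\ B x);
  uf_em : forall A : nat -> Prop, U A \/ U (fun x => ~ A x);
  uf_ge : forall n, U (fun x => n <= x);
  uf_ex : forall A : nat -> Prop, U A -> exists x, A x }.

Lemma ultrafilter_exists : exists U, ultrafilter U.
Proof.
set (F := fun A : nat -> Prop => exists n, forall x, n <= x -> A x).
assert (HF : filter.ProperFilter F).
{ constructor.
  - intros [n Hn]; exact (Hn n (le_n n)).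
  - constructor.
    + exists 0; intros; exact I.
    + intros A B [n Hn] [m Hm]; exists (Nat.max n m); intros x Hx; split;
        [apply Hn | apply Hm]; lia.
    + intros A B HAB [n Hn]; exists n; intros x Hx; apply HAB, Hn, Hx. }
destruct (filter.ultraFilterLemma HF) as [U [HU FU]].
pose proof (filter.filter_filter (ProperFilter := filter.ultra_proper (UltraFilter := HU))) as HUf.
exists U; constructor.
- intros A B HA HAB; exact (filter.filterS (Filter := HUf) HAB HA).
- intros A B HA HB; exact (filter.filterI (Filter := HUf) HA HB).
- intros A; exact (filter.in_ultra_setVsetC A HU).
- intros n; apply FU; exists n; auto.
- intros A HA; exact (filter.filter_ex (FF := filter.ultra_proper (UltraFilter := HU)) HA).
Qed.

(** * Conditions with locked limits *)

(* A condition fixes a coloring on [0, len) and locks the limit of every x < len: from [len] on,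
   f x y keeps the value col x len. Values of [col] outside x < y <= len are irrelevant. *)
Record cond : Type := Cond { len : nat; col : coloring }.

Definition lock (q : cond) (x : nat) : bool := col q x (len q).

(** Truncating [y] at the length reads colors and locks by one formula. *)
Definition cond_le (r q : cond) : Prop :=
  len q <= len r /\
  forall x y, x < y -> x < len q -> col r x (Nat.min y (len r)) = col q x (Nat.min y (len q)).

(* [r] keeps the coloring of [q], but it may break the locks of [q]. *)
Definition ext (r q : cond) : Prop :=
  len q <= len r /\ forall x y, x < y -> y < len q -> col r x y = col q x y.

Definition meets (f : coloring) (q : cond) : Prop :=
  forall x y, x < y -> x < len q -> f x y = col q x (Nat.min y (len q)).

Lemma cond_le_refl q : cond_le q q.
Proof. split; auto. Qed.

Lemma cond_le_trans p q r : cond_le p q -> cond_le q r -> cond_le p r.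
Proof.
intros [l1 H1] [l2 H2]; split; [lia|].
intros x y Hxy Hx; rewrite H1 by lia; apply H2; lia.
Qed.

Lemma ext_refl q : ext q q.
Proof. split; auto. Qed.

Lemma ext_trans p q r : ext p q -> ext q r -> ext p r.
Proof.
intros [l1 H1] [l2 H2]; split; [lia|].
intros x y Hxy Hx; rewrite H1 by lia; apply H2; lia.
Qed.

Lemma le_ext r q : cond_le r q -> ext r q.
Proof.
intros [l H]; split; [lia|].
intros x y Hxy Hy; specialize (H x y Hxy ltac:(lia)).
now rewrite !Nat.min_l in H by lia.
Qed.

Lemma le_lock r q x : cond_le r q -> x < len q -> lock r x = lock q x.
Proof.
intros [l H] Hx; specialize (H x (len r) ltac:(lia) Hx).
now rewrite Nat.min_id, Nat.min_r in H by lia.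
Qed.

(** Both conditions read their values off [f], so the conditions met by one coloring form a chain;
    this lets separate generic facts be combined. *)
Lemma meets_comparable f q r : meets f q -> meets f r -> len q <= len r -> cond_le r q.
Proof.
intros Hq Hr Hl; split; auto.
intros x y Hxy Hx; rewrite <- Hr, <- Hq by lia; reflexivity.
Qed.

Lemma lengthen q N e : exists r, cond_le r q /\ N <= len r /\
  forall v, len q <= v -> v < len r -> lock r v = e.
Proof.
exists (Cond (Nat.max N (len q))
  (fun x y => if x <? len q then col q x (Nat.min y (len q)) else e)).
split; [split|split]; simpl.
- lia.
- intros x y Hxy Hx; apply Nat.ltb_lt in Hx as Hx'; rewrite Hx'.
  f_equal; lia.
- lia.
- intros v H1 H2; unfold lock; simpl.
  destruct (Nat.ltb_spec v (len q)); [lia|reflexivity].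
Qed.

Lemma anti_lock p r N : cond_le r p -> exists q, cond_le q p /\ ext q r /\ N <= len q /\
  forall u v, len p <= u -> u < len r -> len r <= v -> v < len q ->
    col q u v = negb (lock r u).
Proof.
intros [Hl H].
exists (Cond (Nat.max N (len r)) (fun x y =>
  if y <? len r then col r x y
  else if x <? len p then lock p x else negb (lock r x))).
split; [split|split; [split|split]]; simpl.
- lia.
- intros x y Hxy Hx.
  destruct (Nat.ltb_spec (Nat.min y (Nat.max N (len r))) (len r)).
  + specialize (H x y Hxy Hx).
    rewrite (Nat.min_l y (len r)) in H by lia.
    now rewrite (Nat.min_l y) by lia.
  + apply Nat.ltb_lt in Hx as Hx'; rewrite Hx'; unfold lock.
    f_equal; lia.
- lia.
- intros x y Hxy Hy; apply Nat.ltb_lt in Hy; now rewrite Hy.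
- lia.
- intros u v H1 H2 H3 H4.
  destruct (Nat.ltb_spec v (len r)); [lia|].
  destruct (Nat.ltb_spec u (len p)); [lia|reflexivity].
Qed.

(** * Forcing of values and limits *)

(* Computations may use the coloring of [q] but not its locks, so that they survive [ext]. *)
Definition comp (P : prog) (q : cond) (x y : nat) (c : bool) : Prop :=
  forall f : coloring, (forall a b, a < b -> b < len q -> f a b = col q a b) ->
    eval (code f) P [Cantor.to_nat (x, y)] (if c then 1 else 0).

(** Unlike [comp], this depends on the locks: it passes to [cond_le] but not in general to [ext], so
    during the game it can only be promised. *)
Definition forces_lim (P : prog) (q : cond) (x : nat) (c : bool) : Prop :=
  forall r y, cond_le r q -> len q <= y -> x < y -> ~ comp P r x y (negb c).

Lemma comp_ext P q r x y c : ext r q -> comp P q x y c -> comp P r x y c.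
Proof.
intros [Hl H] Hc f Hf; apply Hc; intros a b Hab Hb.
rewrite Hf by lia; apply H; lia.
Qed.

Lemma comp_le P q r x y c : cond_le r q -> comp P q x y c -> comp P r x y c.
Proof. intros H; apply comp_ext, le_ext, H. Qed.

Lemma forces_lim_le P q r x c : cond_le r q -> forces_lim P q x c -> forces_lim P r x c.
Proof.
intros Hr H s y Hs Hy Hxy; apply H; auto.
- eapply cond_le_trans; eauto.
- destruct Hr; lia.
Qed.

Lemma comp_meets P q x y c f : comp P q x y c -> meets f q ->
  eval (code f) P [Cantor.to_nat (x, y)] (if c then 1 else 0).
Proof.
intros H Hf; apply H; intros a b Hab Hb.
rewrite Hf by lia; f_equal; lia.
Qed.

Lemma code_use P (f : coloring) a r : eval (code f) P a r ->
  exists N, forall g : coloring, (forall x y, x < y -> y < N -> f x y = g x y) -> eval (code g) P a r.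
Proof.
intros H; apply eval_use in H as [N HN]; exists (S N); intros g Hg; apply HN.
intros n Hn; unfold code.
destruct (Cantor.of_nat n) as [x y] eqn:E; cbv beta iota.
assert (Hn' : n = Cantor.to_nat (x, y)) by (rewrite <- E; symmetry; apply Cantor.cancel_to_of).
pose proof (Cantor.to_nat_non_decreasing x y).
destruct (Nat.ltb_spec x y); auto.
apply Hg; lia.
Qed.

Lemma comp_of_eval P (f : coloring) x y (c : bool) :
  (forall N, exists q, meets f q /\ N <= len q) ->
  eval (code f) P [Cantor.to_nat (x, y)] (if c then 1 else 0) ->
  exists q, meets f q /\ comp P q x y c.
Proof.
intros Hf H; apply code_use in H as [N HN].
destruct (Hf N) as [q [Hq Hl]]; exists q; split; auto.
intros g Hg; apply HN; intros a b Hab Hb.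
rewrite Hg by lia; rewrite Hq by lia; f_equal; lia.
Qed.

(** * Generic colorings *)

Lemma generic_exists (I : Type) (W : I -> cond -> Prop) : countable I ->
  exists f, stable f /\ (forall N, exists q, meets f q /\ N <= len q) /\
    forall i, exists q, meets f q /\ (W i q \/ forall r, cond_le r q -> ~ W i r).
Proof.
intros [g Hg].
assert (Hstep : forall (k : nat) (q : cond), exists r, cond_le r q /\ S (len q) <= len r /\
   forall i, g i = k -> W i r \/ forall s, cond_le s r -> ~ W i s).
{ intros k q.
  destruct (lengthen q (S (len q)) true) as [r [Hr [Hl _]]].
  destruct (classic (exists i s, g i = k /\ cond_le s r /\ W i s)) as [[i [s [Hi [Hs Hw]]]]|Hn].
  - exists s; split; [eapply cond_le_trans; eauto|split; [destruct Hs; lia|]].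
    intros j Hj; left; replace j with i by (apply Hg; congruence); exact Hw.
  - exists r; split; [auto|split; [auto|]].
    intros j Hj; right; intros s Hs Hw; apply Hn; exists j, s; auto. }
set (next := fun k q => proj1_sig (constructive_indefinite_description _ (Hstep k q))).
assert (Hnext : forall k q, cond_le (next k q) q /\ S (len q) <= len (next k q) /\
   forall i, g i = k -> W i (next k q) \/ forall s, cond_le s (next k q) -> ~ W i s).
{ intros k q; exact (proj2_sig (constructive_indefinite_description _ (Hstep k q))). }
set (Q := fix Q k := match k with 0 => Cond 0 (fun _ _ => true) | S k => next k (Q k) end).
assert (HQ : forall j k, j <= k -> cond_le (Q k) (Q j)).
{ intros j k H; induction H; [apply cond_le_refl|].
  eapply cond_le_trans; [apply Hnext|exact IHle]. }
assert (Hlen : forall k, k <= len (Q k)).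
{ induction k; [lia|]; simpl; destruct (Hnext k (Q k)) as [_ [H _]]; lia. }
(* The length of [Q (S x)] exceeds [x], so the row of [x] is completely fixed there. *)
set (f := fun x y => col (Q (S x)) x (Nat.min y (len (Q (S x))))).
assert (Hf : forall k, meets f (Q k)).
{ intros k x y Hxy Hx; unfold f.
  pose proof (Hlen (S x)).
  destruct (Nat.le_ge_cases k (S x)) as [H'|H']; destruct (HQ _ _ H') as [_ E].
  - apply E; auto.
  - symmetry; apply E; auto; lia. }
exists f; split; [|split].
- intros x; exists (lock (Q (S x)) x), (len (Q (S x))); intros u Hu _.
  unfold f, lock; f_equal; lia.
- intros N; exists (Q N); auto.
- intros i; exists (Q (S (g i))); split; auto.
  apply Hnext; reflexivity.
Qed.

(** * Finite oracles and one-point extensions *)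

(* (b, (L, R)) stands for the oracles that agree with L (+) R below b in each half. *)
Definition state : Type := nat * (list nat * list nat).
Definition bound (s : state) : nat := fst s.
Definition part (i : bool) (s : state) : list nat := if i then snd (snd s) else fst (snd s).
(** For [z] beyond the old bound, the bound [S z] also keeps the skipped numbers out of both halves,
    and [z] out of the other half. *)
Definition add (i : bool) (z : nat) (s : state) : state :=
  (S z, if i then (part false s, z :: part true s) else (z :: part false s, part true s)).

Definition half (i : bool) (H : set) : set := if i then right_part H else left_part H.
Definition elt (i : bool) (u : nat) : nat := if i then 2 * u + 1 else 2 * u.

Definition agrees (H : set) (s : state) : Prop :=
  forall i x, x < bound s -> (half i H x = true <-> In x (part i s)).

Definition outputs (G : prog) (s : state) (i : bool) (u : nat) : Prop :=
  forall H, agrees H s -> eval H G [elt i u] 1.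

Definition extends (t s : state) : Prop :=
  bound s <= bound t /\ forall i x, x < bound s -> (In x (part i t) <-> In x (part i s)).

Definition wf (s : state) : Prop := forall i x, In x (part i s) -> x < bound s.

Lemma extends_refl s : extends s s.
Proof. split; [lia|tauto]. Qed.

Lemma extends_trans s t v : extends s t -> extends t v -> extends s v.
Proof.
intros [l1 H1] [l2 H2]; split; [lia|].
intros i x Hx; rewrite H1 by lia; apply H2; lia.
Qed.

Lemma in_add j z s i x : In x (part i (add j z s)) <-> (i = j /\ x = z) \/ In x (part i s).
Proof. destruct i, j; simpl; intuition congruence. Qed.

Lemma extends_add j z s : bound s <= z -> extends (add j z s) s.
Proof.
intros Hz; split; [simpl; lia|].
intros i x Hx; rewrite in_add; intuition lia.
Qed.

Lemma wf_add j z s : bound s <= z -> wf s -> wf (add j z s).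
Proof.
intros Hz Hs i x; rewrite in_add; intros [[_ ->]|Hx]; simpl; [lia|].
apply Hs in Hx; lia.
Qed.

Lemma agrees_extends H s t : extends t s -> agrees H t -> agrees H s.
Proof.
intros [l Hl] Ht i x Hx; rewrite <- Hl by lia; apply Ht; lia.
Qed.

Lemma outputs_extends G s t i u : extends t s -> outputs G s i u -> outputs G t i u.
Proof. intros Ht Hs H HH; apply Hs; eapply agrees_extends; eauto. Qed.

(** * Bars over an ultrafilter *)

Section Bars.

Variable U : (nat -> Prop) -> Prop.
Hypothesis HU : ultrafilter U.

(* [Q] is a bar for the tree of one-point extensions, branching over [U]-large sets. *)
Inductive unavoidable (Q : state -> Prop) : state -> Prop :=
| unavoidable_now s : Q s -> unavoidable Q s
| unavoidable_later j s S : U S -> (forall z, S z -> unavoidable Q (add j z s)) ->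
    unavoidable Q s.

(** Otherwise the ultrafilter would make the unavoidable extensions large, hence a bar at [s]. Thus
    an avoidance can be maintained along a construction. *)
Lemma avoidable_add Q j s : ~ unavoidable Q s -> U (fun z => ~ unavoidable Q (add j z s)).
Proof.
intros Hs; destruct (uf_em _ HU (fun z => unavoidable Q (add j z s))) as [H|H]; auto.
exfalso; apply Hs; exact (unavoidable_later Q j s _ H (fun z Hz => Hz)).
Qed.

Definition new_output (G : prog) (i : bool) (n : nat) (s : state) : Prop :=
  exists u, n <= u /\ outputs G s i u.

Definition determines (G : prog) (v : nat) : state -> Prop :=
  unavoidable (fun s => outputs G s true v).

(** A large set split into finitely many pieces has a large piece. *)
Lemma ultra_exists_lt (A : nat -> nat -> Prop) B :
  U (fun z => exists v, v < B /\ A v z) -> exists v, v < B /\ U (A v).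
Proof.
induction B as [|B IH]; intros H.
- destruct (uf_ex _ HU _ H) as [z [v [Hv _]]]; lia.
- destruct (uf_em _ HU (A B)) as [HB|HB]; [exists B; split; auto; lia|].
  destruct IH as [v [Hv Hv']]; [|exists v; split; auto; lia].
  apply (uf_up _ HU _ _ (uf_and _ HU _ _ H HB)); intros z [[v [Hv Hz]] HBz].
  exists v; split; auto.
  assert (v <> B) by (intros ->; auto); lia.
Qed.

Variables (G : prog) (n : nat).

(* How one side of the game below gets from its finite oracle to a pair (u, v) of left and right
   outputs of [G]. In the last two rules the next [v] is found beyond any given bound, hence where
   the coloring is still undetermined. The option records u and the promised limit of u. *)
Inductive playable : state -> option (nat * bool) -> Prop :=
| play_stall s o i k : ~ unavoidable (new_output G i k) s -> playable s o
| play_left s u : n <= u -> outputs G s false u -> (forall d, playable s (Some (u, d))) ->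
    playable s None
| play_step j s o S : U S -> (forall z, S z -> playable (add j z s) o) -> playable s o
| play_many s o : (forall B, exists v, B <= v /\ determines G v s) -> playable s (Some o)
| play_jump j s o : (forall B, U (fun z => exists v, B <= v /\ determines G v (add j z s))) ->
    playable s (Some o).

(* If bounded v are never determined at [s] but some new v always is, then along [U] the v
   determined by the one-point extensions tends to infinity. *)
Lemma playable_some s o : playable s (Some o).
Proof.
destruct (classic (forall B, exists v, B <= v /\ determines G v s)) as [H|H].
{ apply play_many; exact H. }
apply not_all_ex_not in H as [k Hk].
assert (Hk' : forall v, k <= v -> ~ determines G v s) by (intros v Hv Hd; apply Hk; eauto).
clear Hk; destruct (classic (unavoidable (new_output G true k) s)) as [Hs|Hs];
  [|eapply play_stall; eauto].
induction Hs as [s [v [Hv Hs]]|j s S HS Hz IH].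
- exfalso; apply (Hk' v Hv); constructor; exact Hs.
- destruct (uf_em _ HU (fun z => exists v, k <= v /\ determines G v (add j z s))) as [H|H].
  + apply play_jump with j; intros B.
    destruct (uf_em _ HU (fun z => exists v, B <= v /\ determines G v (add j z s)))
      as [HB|HB]; auto.
    exfalso.
    (* If the determined [v] stayed below [B], a single [v] would serve for [U]-many [z], and would
       then already be determined at [s]. *)
    destruct (ultra_exists_lt (fun v z => k <= v /\ determines G v (add j z s)) B)
      as [v [Hv Hd]].
    { apply (uf_up _ HU _ _ (uf_and _ HU _ _ H HB)); intros z [[v [Hv Hd]] HBz].
      exists v; split; auto.
      destruct (Nat.lt_ge_cases v B); auto; exfalso; eauto. }
    destruct (uf_ex _ HU _ Hd) as [z [Hkv _]].
    apply (Hk' v Hkv); apply unavoidable_later with (j := j) (S := fun z => determines G v (add j z s)).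
    * apply (uf_up _ HU _ _ Hd); tauto.
    * auto.
  (* Shrinking [S] preserves the bound [k] at the extension, as the induction hypothesis
     requires. *)
  + apply play_step with j (fun z => S z /\ ~ (exists v, k <= v /\ determines G v (add j z s))).
    * apply (uf_and _ HU); auto.
    * intros z [HSz Hn]; apply IH; auto.
      intros v Hv Hd; apply Hn; eauto.
Qed.

Lemma playable_none s : playable s None.
Proof.
destruct (classic (unavoidable (new_output G false n) s)) as [Hs|Hs];
  [|eapply play_stall; eauto].
induction Hs as [s [u [Hu Hs]]|j s S HS Hz IH].
- eapply play_left; eauto; intros d; apply playable_some.
- eapply play_step; eauto.
Qed.

End Bars.

(** * Sound oracles and successful diagonalization *)

Definition sound (P : prog) (c : bool) (q : cond) (s : state) : Prop :=
  wf s /\ (forall x, In x (part false s) -> forces_lim P q x c) /\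
  forall x y, In x (part false s) -> In y (part true s) -> x < y -> comp P q x y c.

(** In a p-homogeneous set with [u] on the left and [v] on the right, large right elements show the
    limit of [u] and large left elements that of [v]; both must equal the color of the pair. *)
Definition bad_pair (q : cond) (u v : nat) : Prop :=
  u < v /\ v < len q /\ (col q u v <> lock q u \/ lock q u <> lock q v).

Definition success (U : (nat -> Prop) -> Prop) (P G : prog) (J : state -> Prop) (s0 : state)
    (c : bool) (q : cond) (s : state) : Prop :=
  sound P c q s /\ extends s s0 /\ J s /\
  ((exists i k, ~ unavoidable U (new_output G i k) s) \/
   exists u v, bad_pair q u v /\ outputs G s false u /\ outputs G s true v).

Lemma sound_le P c r q s : cond_le r q -> sound P c q s -> sound P c r s.
Proof.
intros Hr [H1 [H2 H3]]; split; [auto|split].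
- intros x Hx; eapply forces_lim_le; eauto.
- intros x y Hx Hy Hxy; eapply comp_le; eauto.
Qed.

Lemma bad_pair_le r q u v : cond_le r q -> bad_pair q u v -> bad_pair r u v.
Proof.
intros Hr [Huv [Hv H]]; split; [auto|].
pose proof (le_ext _ _ Hr) as [Hl He].
split; [lia|].
rewrite !(le_lock r q) by (auto; lia); rewrite He by lia; exact H.
Qed.

(** * The two-color game *)

(* The game between the two possible colors of the solution, played on conditions below [p].
   Side [c] owns a finite oracle whose left part is promised to have f'-limit [c]; it wins when
   its functional outputs a pair that is not p-homogeneous, or can be prevented from giving
   further outputs. *)
Section Game.

Variable U : (nat -> Prop) -> Prop.
Hypothesis HU : ultrafilter U.
Variables (P : prog) (p : cond).
Hypothesis total_below : forall q x y, cond_le q p -> x < y -> exists r c, cond_le r q /\ comp P r x y c.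
Hypothesis decided_below : forall q x, cond_le q p -> exists r c, cond_le r q /\ forces_lim P r x c.
Variable alive : bool -> Prop.
Hypothesis alive_spec : forall c, alive c -> forall q S, cond_le q p -> U S ->
  exists r x, cond_le r q /\ S x /\ forces_lim P r x c.
Hypothesis dead_spec : forall c, ~ alive c ->
  exists S, U S /\ forall r x, cond_le r p -> S x -> ~ forces_lim P r x c.
(** [J] abstracts the avoidances accumulated against earlier functionals. *)
Variables (G : bool -> prog) (J : bool -> state -> Prop) (start : bool -> state).
Hypothesis J_add : forall c j s, J c s -> U (fun z => J c (add j z s)).

Definition some_side_succeeds : Prop := exists c q s, alive c /\ cond_le q p /\
  success U P (G c) (J c) (start c) c q s.

(** The limit [c] is forced at [r] and [y] is not below [len r], so whatever value totality provides
    must be [c]. The pairs are treated one by one. *)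
Lemma comp_list c y l r q : cond_le r p -> len r <= y -> cond_le q r ->
  (forall x, In x l -> forces_lim P r x c) ->
  exists q', cond_le q' q /\ forall x, In x l -> x < y -> comp P q' x y c.
Proof.
intros Hr Hy Hqr; induction l as [|a l IH]; intros Hl.
- exists q; split; [apply cond_le_refl|intros x []].
- destruct IH as [q1 [Hq1 HqL]]; [intros; apply Hl; now right|].
  assert (Hq1r : cond_le q1 r) by (eapply cond_le_trans; eauto).
  destruct (Nat.lt_ge_cases a y) as [Hay|Hay].
  + destruct (total_below q1 a y) as [q2 [d [Hq2 Hd]]]; [eapply cond_le_trans; eauto|auto|].
    exists q2; split; [eapply cond_le_trans; eauto|].
    intros x [<-|Hx] Hxy.
    * destruct (bool_dec d c) as [->|Hdc]; [exact Hd|].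
      exfalso; apply (Hl a (or_introl eq_refl) q2 y); auto.
      -- eapply cond_le_trans; eauto.
      -- replace (negb c) with d by (destruct c, d; simpl; congruence); exact Hd.
    * eapply comp_le; [exact Hq2|]; auto.
  + exists q1; split; [auto|].
    intros x [<-|Hx] Hxy; [lia|auto].
Qed.

(** Limits are forced at [r] and [y] is measured against [len r] only, so [q] may already be longer
    than [y]. This allows new locks to be set before [y] enters. *)
Lemma add_right_at c r q s y : cond_le r p -> sound P c r s -> cond_le q r -> len r <= y -> bound s <= y ->
  exists q', cond_le q' q /\ sound P c q' (add true y s).
Proof.
intros Hr Hs Hq Hy Hb; pose proof Hs as [Hw [Hlim Hc]].
destruct (comp_list c y (part false s) r q Hr Hy Hq Hlim) as [q' [Hq' HqL]].
assert (Hq'r : cond_le q' r) by (eapply cond_le_trans; eauto).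
exists q'; split; [auto|split; [apply wf_add; auto|split]].
- intros x Hx; apply in_add in Hx as [[? _]|Hx]; [discriminate|].
  eapply forces_lim_le; eauto.
- intros x z Hx Hz Hxz; apply in_add in Hx as [[? _]|Hx]; [discriminate|].
  apply in_add in Hz as [[_ ->]|Hz]; [auto|].
  eapply comp_le; eauto.
Qed.

Lemma add_right c r s S : cond_le r p -> sound P c r s -> U S ->
  exists y q, S y /\ bound s <= y /\ cond_le q r /\ sound P c q (add true y s).
Proof.
intros Hr Hs HS.
destruct (uf_ex _ HU _ (uf_and _ HU _ _ HS (uf_ge _ HU (bound s + len r)))) as [y [HSy Hy]].
destruct (add_right_at c r r s y) as [q [Hq Hq']]; auto; [apply cond_le_refl|lia|lia|].
exists y, q; split; [auto|split; [lia|auto]].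
Qed.

(** The new [x] lies above all right elements, so it creates no increasing pair. *)
Lemma sound_add_left c q s x : bound s <= x -> sound P c q s -> forces_lim P q x c ->
  sound P c q (add false x s).
Proof.
intros Hx [Hw [Hl Hc]] Hlim; split; [apply wf_add; auto|split].
- intros a Ha; apply in_add in Ha as [[_ ->]|Ha]; auto.
- intros a b Ha Hb Hab.
  apply in_add in Hb as [[? _]|Hb]; [discriminate|].
  apply in_add in Ha as [[_ ->]|Ha]; auto.
  apply Hw in Hb; lia.
Qed.

(** A bad pair survives stronger conditions, so it remains to follow the bar until [v] is output,
    with left points from [alive_spec] and right points from [add_right]. *)
Lemma finish c u v s : alive c -> determines U (G c) v s ->
  forall q, cond_le q p -> sound P c q s -> extends s (start c) -> J c s ->
  outputs (G c) s false u -> bad_pair q u v -> some_side_succeeds.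
Proof.
intros Ha Hd; induction Hd as [s Hs|j s S HS _ IH]; intros q Hq Hso He HJ Hu Hb.
- exists c, q, s; split; [auto|split; [auto|]].
  split; [auto|split; [auto|split; [auto|right; eauto]]].
- pose proof (uf_and _ HU _ _ HS (uf_and _ HU _ _ (J_add c j s HJ) (uf_ge _ HU (bound s)))) as HT.
  destruct j.
  + destruct (add_right c q s _ Hq Hso HT) as [y [r [[HSy [HJy Hy]] [_ [Hr Hsr]]]]].
    apply (IH y HSy r); auto.
    * eapply cond_le_trans; eauto.
    * eapply extends_trans; eauto; apply extends_add; auto.
    * eapply outputs_extends; eauto; apply extends_add; auto.
    * eapply bad_pair_le; eauto.
  + destruct (alive_spec c Ha q _ Hq HT) as [r [x [Hr [[HSx [HJx Hx]] Hl]]]].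
    apply (IH x HSx r); auto.
    * eapply cond_le_trans; eauto.
    * apply sound_add_left; auto; eapply sound_le; eauto.
    * eapply extends_trans; eauto; apply extends_add; auto.
    * eapply outputs_extends; eauto; apply extends_add; auto.
    * eapply bad_pair_le; eauto.
Qed.

(** * Positions and recurrent promises *)

Definition side : Type := state * option (nat * bool).

Definition side_promise (c : bool) (a : side) (r : cond) : Prop :=
  (forall x, In x (part false (fst a)) -> forces_lim P r x c) /\
  forall u d, snd a = Some (u, d) -> u < len r /\ lock r u = d.

Definition promise (sg : bool -> side) (r : cond) : Prop := forall c, side_promise c (sg c) r.

(* Whatever is done to the locks of [q], the promise [T] can be restored. *)
Definition recurrent (T : cond -> Prop) (q : cond) : Prop :=
  forall q', cond_le q' p -> ext q' q -> exists r, cond_le r p /\ ext r q' /\ T r.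

(** This is the part of a position that outlasts broken locks, in contrast to [side_promise]. The
    bound [len p <= u] keeps [u] within the reach of [anti_lock]. *)
Definition side_ok (c : bool) (a : side) (q : cond) : Prop :=
  wf (fst a) /\ extends (fst a) (start c) /\ J c (fst a) /\
  (forall x y, In x (part false (fst a)) -> In y (part true (fst a)) -> x < y -> comp P q x y c) /\
  forall u d, snd a = Some (u, d) -> len p <= u /\ outputs (G c) (fst a) false u.

Definition position (sg : bool -> side) (q : cond) : Prop :=
  cond_le q p /\ recurrent (promise sg) q /\ forall c, side_ok c (sg c) q.

Definition win (sg : bool -> side) : Prop := forall q, position sg q -> some_side_succeeds.

Definition upd (sg : bool -> side) (c : bool) (a : side) : bool -> side :=
  fun c' => if Bool.eqb c c' then a else sg c'.

Lemma side_promise_le c a r q : cond_le r q -> side_promise c a q -> side_promise c a r.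
Proof.
intros Hr [H1 H2]; split.
- intros x Hx; eapply forces_lim_le; eauto.
- intros u d Hud; destruct (H2 u d Hud) as [Hu Hd]; split.
  + destruct Hr; lia.
  + rewrite (le_lock r q); auto.
Qed.

Lemma promise_le sg r q : cond_le r q -> promise sg q -> promise sg r.
Proof. intros Hr H c; eapply side_promise_le; eauto. Qed.

Lemma recurrent_ext T r q : ext r q -> recurrent T q -> recurrent T r.
Proof. intros Hr H q' Hq' He; apply H; auto; eapply ext_trans; eauto. Qed.

Lemma recurrent_imp (T T' : cond -> Prop) q : (forall r, T r -> T' r) ->
  recurrent T q -> recurrent T' q.
Proof. intros HT H q' Hq' He; destruct (H q' Hq' He) as [r [? [? ?]]]; eauto. Qed.

(** If [T] with [D false] is not recurrent, some [q1] excludes the two together from then on. Every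
    restoration of [T] beyond [q1] can still be decided, necessarily as [true]. *)
Lemma recurrent_decide (T : cond -> Prop) (D : bool -> cond -> Prop) q :
  (forall r s, cond_le s r -> T r -> T s) ->
  (forall r, cond_le r p -> T r -> exists s d, cond_le s r /\ D d s) ->
  recurrent T q -> cond_le q p ->
  exists q1 d, cond_le q1 p /\ ext q1 q /\ recurrent (fun r => T r /\ D d r) q1.
Proof.
intros HT HD HR Hq.
destruct (classic (recurrent (fun r => T r /\ D false r) q)) as [Hf|Hf].
{ exists q, false; split; [auto|split; [apply ext_refl|auto]]. }
apply not_all_ex_not in Hf as [q1 Hf].
apply imply_to_and in Hf as [Hq1 Hf]; apply imply_to_and in Hf as [He1 Hf].
exists q1, true; split; [auto|split; [auto|]].
intros q2 Hq2 He2.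
destruct (HR q2 Hq2) as [r [Hr [Her Tr]]]; [eapply ext_trans; eauto|].
destruct (HD r Hr Tr) as [s [d [Hs Ds]]].
assert (Hsp : cond_le s p) by (eapply cond_le_trans; eauto).
assert (Hse : ext s q2) by exact (ext_trans _ _ _ (le_ext _ _ Hs) Her).
exists s; split; [auto|split; [auto|split; [eauto|]]].
destruct d; auto.
exfalso; apply Hf; exists s; split; [auto|split; [eapply ext_trans; eauto|eauto]].
Qed.

Lemma side_ok_ext c a r q : ext r q -> side_ok c a q -> side_ok c a r.
Proof.
intros Hr [H1 [H2 [H3 [H4 H5]]]]; split; [auto|split; [auto|split; [auto|split; [|auto]]]].
intros x y Hx Hy Hxy; eapply comp_ext; eauto.
Qed.

Lemma position_sound sg c q r : ext r q -> position sg q -> promise sg r ->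
  sound P c r (fst (sg c)).
Proof.
intros He [_ [_ HO]] HP; destruct (HO c) as [H1 [_ [_ [H4 _]]]].
split; [auto|split; [apply HP|]].
intros x y Hx Hy Hxy; eapply comp_ext; eauto.
Qed.

Lemma position_promise sg q : position sg q -> exists r, cond_le r p /\ ext r q /\ promise sg r.
Proof. intros [Hq [HR _]]; apply HR; auto; apply ext_refl. Qed.

Lemma position_upd sg c a q q1 : position sg q -> cond_le q1 p -> ext q1 q ->
  recurrent (fun r => promise sg r /\ side_promise c a r) q1 -> side_ok c a q1 ->
  position (upd sg c a) q1.
Proof.
intros [_ [_ HO]] Hq1 He HR Ha; split; [auto|split].
- eapply recurrent_imp; [|exact HR].
  intros r [Hr1 Hr2] c'; unfold upd.
  destruct (Bool.eqb_spec c c') as [<-|]; auto.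
- intros c'; unfold upd; destruct (Bool.eqb_spec c c') as [<-|]; auto.
  eapply side_ok_ext; eauto.
Qed.

(** * Moves that one side makes alone *)

Lemma win_stall sg c i k : alive c ->
  ~ unavoidable U (new_output (G c) i k) (fst (sg c)) -> win sg.
Proof.
intros Ha Hi q Hq; destruct (position_promise sg q Hq) as [r [Hr [He HP]]].
exists c, r, (fst (sg c)); split; [auto|split; [auto|]].
split; [eapply position_sound; eauto|].
destruct Hq as [_ [_ HO]]; destruct (HO c) as [_ [? [? _]]].
split; [auto|split; [auto|left; eauto]].
Qed.

(** The limit of [u] is not chosen freely: [recurrent_decide] supplies a [d] that can always be
    restored, so a win is required for both values. *)
Lemma win_left sg c u : len p <= u -> outputs (G c) (fst (sg c)) false u ->
  (forall d, win (upd sg c (fst (sg c), Some (u, d)))) -> win sg.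
Proof.
intros Hu Ho Hw q Hq.
destruct (recurrent_decide (promise sg) (fun d r => u < len r /\ lock r u = d) q)
  as [q1 [d [Hq1 [He HR]]]].
- intros r s Hs; apply promise_le; auto.
- intros r Hr Hp; destruct (lengthen r (S u) true) as [s [Hs [Hl _]]].
  exists s, (lock s u); auto.
- apply Hq.
- apply Hq.
- apply (Hw d q1); eapply position_upd; eauto.
  + eapply recurrent_imp; [|exact HR].
    intros r [Hr1 Hr2]; split; auto; split; [apply Hr1|].
    simpl; intros u' d' E; injection E as <- <-; exact Hr2.
  + pose proof Hq as [_ [_ HO]]; destruct (HO c) as [H1 [H2 [H3 [H4 H5]]]].
    split; [auto|split; [auto|split; [auto|split]]]; simpl.
    * intros; eapply comp_ext; eauto.
    * intros u' d' E; injection E as <- <-; auto.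
Qed.

(** A right point adds only computed values, which survive [ext]; it is added where the promise
    holds, and the promise stays recurrent. *)
Lemma win_right sg c S : U S ->
  (forall y, S y -> win (upd sg c (add true y (fst (sg c)), snd (sg c)))) -> win sg.
Proof.
intros HS Hw q Hq; destruct (position_promise sg q Hq) as [r [Hr [He HP]]].
pose proof Hq as [_ [HR HO]]; destruct (HO c) as [H1 [H2 [H3 [H4 H5]]]].
destruct (add_right c r (fst (sg c)) _ Hr (position_sound sg c q r He Hq HP)
  (uf_and _ HU _ _ HS (J_add c true _ H3))) as [y [q1 [[HSy HJy] [Hy [Hq1 Hs]]]]].
assert (Hq1p : cond_le q1 p) by (eapply cond_le_trans; eauto).
assert (He1 : ext q1 q) by exact (ext_trans _ _ _ (le_ext _ _ Hq1) He).
pose proof (extends_add true y _ Hy) as Hext.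
apply (Hw y HSy q1); eapply position_upd; eauto.
- eapply recurrent_imp; [|eapply recurrent_ext; eauto].
  intros s Hs'; split; auto; destruct (Hs' c) as [Hs1 Hs2]; split; auto.
- split; [apply Hs|split; [eapply extends_trans; eauto|split; [auto|split; [apply Hs|]]]].
  simpl; intros u d E; destruct (H5 u d E); split; auto.
  eapply outputs_extends; eauto.
Qed.

Lemma promised_lock sg c u d q r : position sg q -> promise sg r -> snd (sg c) = Some (u, d) ->
  len p <= u /\ outputs (G c) (fst (sg c)) false u /\ u < len r /\ lock r u = d.
Proof.
intros [_ [_ HO]] HP E; destruct (HO c) as [_ [_ [_ [_ H5]]]], (HP c) as [_ H6].
destruct (H5 u d E), (H6 u d E); auto.
Qed.

Lemma lock_against r u v : cond_le r p -> u < len r -> len r <= v ->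
  exists s, cond_le s r /\ bad_pair s u v.
Proof.
intros Hr Hu Hv; destruct (lengthen r (S v) (negb (lock r u))) as [s [Hs [Hl Hlock]]].
exists s; split; auto; split; [lia|split; [lia|right]].
rewrite (le_lock s r u), Hlock by (auto; lia); destruct (lock r u); discriminate.
Qed.

Lemma win_many sg c o : alive c -> snd (sg c) = Some o ->
  (forall B, exists v, B <= v /\ determines U (G c) v (fst (sg c))) -> win sg.
Proof.
intros Ha Eo Hm q Hq; destruct (position_promise sg q Hq) as [r [Hr [He HP]]].
destruct o as [u d].
destruct (promised_lock sg c u d q r Hq HP Eo) as [Hu1 [Hu2 [Hu3 Hu4]]].
destruct (Hm (len r)) as [v [Hv Hd]].
destruct (lock_against r u v Hr Hu3 Hv) as [s [Hs Hb]].
pose proof Hq as [_ [HR HO]]; destruct (HO c) as [H1 [H2 [H3 [H4 H5]]]].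
apply (finish c u v (fst (sg c)) Ha Hd s); auto.
- eapply cond_le_trans; eauto.
- eapply sound_le; eauto; eapply position_sound; eauto.
Qed.

(** Both [y] and [v] are taken beyond [len r]; [v] is locked against [u] first, and only then does
    [y] enter. *)
Lemma win_jump_right sg c o : alive c -> snd (sg c) = Some o ->
  (forall B, U (fun z => exists v, B <= v /\ determines U (G c) v (add true z (fst (sg c))))) ->
  win sg.
Proof.
intros Ha Eo Hm q Hq; destruct (position_promise sg q Hq) as [r [Hr [He HP]]].
destruct o as [u d].
destruct (promised_lock sg c u d q r Hq HP Eo) as [Hu1 [Hu2 [Hu3 Hu4]]].
pose proof Hq as [_ [HR HO]]; destruct (HO c) as [H1 [H2 [H3 [H4 H5]]]].
destruct (uf_ex _ HU _ (uf_and _ HU _ _ (Hm (len r))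
  (uf_and _ HU _ _ (J_add c true _ H3) (uf_ge _ HU (len r + bound (fst (sg c))))))) as [y [[v [Hv Hd]] [HJy Hy]]].
destruct (lock_against r u v Hr Hu3 Hv) as [s [Hs Hb]].
destruct (add_right_at c r s (fst (sg c)) y Hr) as [s' [Hs' Hso]];
  [eapply position_sound; eauto|auto|lia|lia|].
pose proof (extends_add true y (fst (sg c)) ltac:(lia)) as Hext.
apply (finish c u v _ Ha Hd s'); auto.
- eapply cond_le_trans; eauto; eapply cond_le_trans; eauto.
- eapply extends_trans; eauto.
- eapply outputs_extends; eauto.
- eapply bad_pair_le; eauto.
Qed.

(** * Joint moves on the left parts *)

Definition progresses (sg : bool -> side) (c : bool) : Prop :=
  (exists S, U S /\ forall x, S x -> win (upd sg c (add false x (fst (sg c)), snd (sg c)))) \/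
  exists o, snd (sg c) = Some o /\
    forall B, U (fun x => exists v, B <= v /\ determines U (G c) v (add false x (fst (sg c)))).

(* The same [x] is offered to both sides, and whichever color its limit takes is the side that
   gains. Before the color of [x] is decided, a block of columns contradicting the promised locks
   is inserted: it contains the numbers [v] that [x] makes the jumping sides determine. *)
Lemma win_left_part sg : (forall c, alive c -> progresses sg c) -> win sg.
Proof.
intros Hpr q Hq; destruct (position_promise sg q Hq) as [r [Hr [He HP]]].
pose proof Hq as [_ [HR HO]].
(* What may happen if the limit of [x] becomes [c]: this is impossible, or the enlarged side wins,
   or some [v] between [len r] and [N] is determined. *)
set (react := fun c x N =>
  (forall s, cond_le s p -> ~ forces_lim P s x c) \/
  alive c /\ (win (upd sg c (add false x (fst (sg c)), snd (sg c))) \/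
    exists u d v, snd (sg c) = Some (u, d) /\ len r <= v /\ v < N /\
      determines U (G c) v (add false x (fst (sg c))))).
assert (HS : forall c, exists S, U S /\ forall x, S x -> exists N, react c x N).
{ intros c; destruct (classic (alive c)) as [Ha|Ha].
  - destruct (Hpr c Ha) as [[S [HS Hw]]|[[u d] [Eo Hj]]].
    + exists S; split; auto; intros x Hx; exists 0; right; auto.
    + eexists; split; [apply (Hj (len r))|].
      intros x [v [Hv Hd]]; exists (S v); right; split; auto; right.
      exists u, d, v; auto.
  - destruct (dead_spec c Ha) as [S [HS Hd]].
    exists S; split; auto; intros x Hx; exists 0; left; intros s Hs; apply Hd; auto. }
assert (HS' : forall c, exists S, U S /\ forall x, S x ->
   J c (add false x (fst (sg c))) /\ bound (fst (sg c)) <= x /\ exists N, react c x N).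
{ intros c; destruct (HS c) as [S [HS1 HS2]], (HO c) as [_ [_ [HJ _]]].
  eexists; split; [exact (uf_and _ HU _ _ HS1 (uf_and _ HU _ _ (J_add c false _ HJ)
    (uf_ge _ HU (bound (fst (sg c))))))|].
  intros x [? [? ?]]; auto. }
destruct (HS' false) as [S0 [HS0 H0]], (HS' true) as [S1 [HS1 H1]].
destruct (uf_ex _ HU _ (uf_and _ HU _ _ HS0 HS1)) as [x [Hx0 Hx1]].
assert (Hx : exists N, forall c,
   J c (add false x (fst (sg c))) /\ bound (fst (sg c)) <= x /\ react c x N).
{ destruct (H0 x Hx0) as [HJ0 [Hb0 [N0 HN0]]], (H1 x Hx1) as [HJ1 [Hb1 [N1 HN1]]].
  exists (N0 + N1); intros c.
  (* Monotonicity in [N] gives one block serving both colors. *)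
  assert (Hmono : forall N N', N <= N' -> react c x N -> react c x N').
  { intros N N' HN [Hd|[Ha [Hw|[u [d [v [E [? [? ?]]]]]]]]]; [left; auto|right; auto|].
    right; split; auto; right; exists u, d, v; repeat split; auto; lia. }
  destruct c; (split; [|split]); auto; (eapply Hmono; [|eassumption]); lia. }
clear H0 H1 HS HS' HS0 HS1 Hx0 Hx1; destruct Hx as [N Hx].
(* The block is laid before the color of [x] is known, hence for either side. *)
destruct (anti_lock p r N Hr) as [q1 [Hq1 [He1 [HN Hal]]]].
assert (He1q : ext q1 q) by (eapply ext_trans; eauto).
destruct (recurrent_decide (promise sg) (fun d s => forces_lim P s x d) q1)
  as [q2 [c [Hq2 [He2 HR2]]]]; auto.
{ intros s t Ht; apply promise_le; auto. }
{ eapply recurrent_ext; eauto. }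
assert (He2q : ext q2 q) by (eapply ext_trans; eauto).
destruct (Hx c) as [HJ [Hb Hrx]], (HO c) as [H1 [H2 [H3 [H4 H5]]]].
pose proof (extends_add false x _ Hb) as Hext.
destruct Hrx as [Hd|[Ha [Hw|[u [d [v [E [Hv1 [Hv2 Hd]]]]]]]]].
- destruct (HR2 q2 Hq2 (ext_refl _)) as [s [Hs [_ [_ Hl]]]]; exfalso; eapply Hd; eauto.
- apply (Hw q2); eapply position_upd; eauto.
  + eapply recurrent_imp; [|exact HR2].
    intros s [Hs1 Hs2]; split; auto; destruct (Hs1 c) as [Hs3 Hs4]; split; auto.
    intros z Hz; apply in_add in Hz as [[_ ->]|Hz]; auto.
  + split; [apply wf_add; auto|split; [eapply extends_trans; eauto|split; [auto|split]]].
    * intros a b Hia Hib Hab.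
      apply in_add in Hib as [[? _]|Hib]; [discriminate|].
      apply in_add in Hia as [[_ ->]|Hia]; [apply H1 in Hib; lia|].
      eapply comp_ext; eauto.
    * simpl; intros u d E; destruct (H5 u d E); split; auto.
      eapply outputs_extends; eauto.
- destruct (promised_lock sg c u d q r Hq HP E) as [Hu1 [Hu2 [Hu3 Hu4]]].
  destruct (HR2 q2 Hq2 (ext_refl _)) as [s [Hs [Hse [Hsp Hsl]]]].
  destruct (promised_lock sg c u d q s Hq Hsp E) as [_ [_ [Hu5 Hu6]]].
  assert (Hsq1 : ext s q1) by (eapply ext_trans; eauto).
  apply (finish c u v _ Ha Hd s); auto.
  + apply sound_add_left; auto; eapply position_sound; [|exact Hq|exact Hsp].
    eapply ext_trans; eauto.
  + eapply extends_trans; eauto.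
  + eapply outputs_extends; eauto.
  (* At [s] the lock of [u] is [d] again, while the color of [u] and [v] is still the opposite one
     from the block. *)
  + destruct Hsq1 as [Hl1 Hc1]; split; [lia|split; [lia|left]].
    rewrite Hc1, Hal by lia; rewrite Hu4, Hu6; destruct d; discriminate.
Qed.

(** * Well-founded induction over both sides *)

Definition two_sides (c : bool) (a b : side) : bool -> side :=
  fun c' => if Bool.eqb c c' then a else b.

Lemma two_sides_same c a b : two_sides c a b c = a.
Proof. unfold two_sides; now rewrite Bool.eqb_reflx. Qed.

Lemma two_sides_other c a b : two_sides c a b (negb c) = b.
Proof. destruct c; reflexivity. Qed.

Lemma upd_two_sides c a b a' : upd (two_sides c a b) c a' = two_sides c a' b.
Proof. apply functional_extensionality; intros []; destruct c; reflexivity. Qed.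

Lemma upd_two_sides_other c a b b' : upd (two_sides c a b) (negb c) b' = two_sides c a b'.
Proof. apply functional_extensionality; intros []; destruct c; reflexivity. Qed.

Definition moves (c : bool) (s : state) (o : option (nat * bool)) (Q : side -> Prop) : Prop :=
  (exists i k, ~ unavoidable U (new_output (G c) i k) s) \/
  (exists u, o = None /\ len p <= u /\ outputs (G c) s false u /\ forall d, Q (s, Some (u, d))) \/
  (exists j S, U S /\ forall z, S z -> Q (add j z s, o)) \/
  (exists o', o = Some o' /\ forall B, exists v, B <= v /\ determines U (G c) v s) \/
  (exists j o', o = Some o' /\
     forall B, U (fun z => exists v, B <= v /\ determines U (G c) v (add j z s))).

(** Every side is playable, so the rules of [playable] give an induction over sides; [moves] is one
    rule with [Q] for the recursive premises. *)
Lemma moves_ind c (Q : side -> Prop) : (forall s o, moves c s o Q -> Q (s, o)) ->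
  forall a, Q a.
Proof.
unfold moves; intros HQ [s o].
assert (H : playable U (G c) (len p) s o)
  by (destruct o; [apply playable_some | apply playable_none]; exact HU).
induction H; apply HQ.
- left; eauto.
- right; left; eauto 10.
- right; right; left; eauto 10.
- right; right; right; left; eauto 10.
- right; right; right; right; eauto 10.
Qed.

Lemma win_step sg c s o (Q : side -> Prop) : alive c -> sg c = (s, o) ->
  (forall a, Q a -> win (upd sg c a)) -> moves c s o Q -> win sg \/ progresses sg c.
Proof.
intros Ha E HQ [[i [k H]]|[[u [-> [Hu [Ho H]]]]|[[j [S [HS H]]]|[[o' [-> H]]|[j [o' [-> H]]]]]]].
- left; apply (win_stall sg c i k); auto; rewrite E; exact H.
- left; apply (win_left sg c u); rewrite ?E; simpl; auto.
- destruct j.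
  + left; apply (win_right sg c S HS); rewrite E; simpl; auto.
  + right; left; exists S; split; auto; rewrite E; simpl; auto.
- left; apply (win_many sg c o'); rewrite ?E; auto.
- destruct j.
  + left; apply (win_jump_right sg c o'); rewrite ?E; auto.
  + right; right; exists o'; rewrite E; auto.
Qed.

(** Induction on side [c] against a fixed opponent. A left move of [c] waits until an alive opponent
    also needs a left point; then [win_left_part] applies. *)
Lemma win_against c b : alive c ->
  (forall a, alive (negb c) -> win (two_sides c a b) \/ progresses (two_sides c a b) (negb c)) ->
  forall a, win (two_sides c a b).
Proof.
intros Ha Hb; apply (moves_ind c); intros s o Hm.
destruct (win_step (two_sides c (s, o) b) c s o (fun a => win (two_sides c a b)) Ha
  (two_sides_same _ _ _)) as [Hw|Hp]; auto.
{ intros a Hw; now rewrite upd_two_sides. }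
destruct (classic (alive (negb c) -> progresses (two_sides c (s, o) b) (negb c))) as [Ho|Ho].
- apply win_left_part; intros c' Hc'.
  destruct (bool_dec c c') as [<-|Hne]; auto.
  replace c' with (negb c) in * by (destruct c, c'; simpl; congruence); auto.
- apply imply_to_and in Ho as [Ho Hn]; destruct (Hb (s, o) Ho); tauto.
Qed.

(** The outer induction on [negb c] quantifies over all sides [a], so the inner induction may
    restart after each move of the opponent. *)
Lemma win_two_sides c : alive c -> forall a b, win (two_sides c a b).
Proof.
intros Ha.
destruct (classic (alive (negb c))) as [Hn|Hn].
- intros a b; revert b a; apply (moves_ind (negb c) (fun b => forall a, win (two_sides c a b))).
  intros s o Hm; apply (win_against c (s, o) Ha); intros a _.
  apply (win_step _ (negb c) s o (fun b => forall a, win (two_sides c a b)) Hn);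
    [apply two_sides_other|intros b Hb; rewrite upd_two_sides_other; apply Hb|exact Hm].
- intros a b; apply win_against; auto; intros; contradiction.
Qed.

Theorem some_success c : alive c ->
  (forall d, sound P d p (start d) /\ J d (start d)) -> some_side_succeeds.
Proof.
intros Ha Hst.
apply (win_two_sides c Ha (start c, None) (start (negb c), None) p).
replace (two_sides c (start c, None) (start (negb c), None)) with (fun d => (start d, @None (nat * bool)))
  by (apply functional_extensionality; intros []; destruct c; reflexivity).
split; [apply cond_le_refl|split].
(* Before any [u] is chosen, the promise holds at every condition below [p]. *)
- intros q Hq _; exists q; split; [auto|split; [apply ext_refl|]].
  intros d; split; simpl; [|discriminate].
  intros x Hx; eapply forces_lim_le; eauto; now apply Hst.
- intros d; destruct (Hst d) as [[Hw [_ Hc]] HJ].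
  split; [auto|split; [apply extends_refl|split; [auto|split; [auto|discriminate]]]].
Qed.

End Game.

(** * Avoidance constraints and the generic requirements *)

Definition avoids (U : (nat -> Prop) -> Prop) (L : list (prog * (bool * nat))) (s : state) : Prop :=
  forall g i k, In (g, (i, k)) L -> ~ unavoidable U (new_output g i k) s.

Lemma avoids_add U L j s : ultrafilter U -> avoids U L s -> U (fun z => avoids U L (add j z s)).
Proof.
intros HU; induction L as [|[g [i k]] L IH]; intros Hs.
- apply (uf_up _ HU _ _ (uf_ge _ HU 0)); intros z _ g i k [].
- assert (HL : avoids U L s) by (intros g' i' k' H; apply Hs; now right).
  pose proof (avoidable_add U HU _ j s (Hs g i k (or_introl eq_refl))) as H1.
  apply (uf_up _ HU _ _ (uf_and _ HU _ _ H1 (IH HL))).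
  intros z [Hz HzL] g' i' k' [E|H]; [|auto].
  injection E as <- <- <-; exact Hz.
Qed.

Definition decides (f : coloring) (W : cond -> Prop) : Prop :=
  exists q, meets f q /\ (W q \/ forall r, cond_le r q -> ~ W r).

Definition constraint : Type := (list (prog * (bool * nat)) * state)%type.

Definition partial_at (P : prog) (q : cond) : Prop :=
  exists x y, x < y /\ forall r c, cond_le r q -> ~ comp P r x y c.

Definition undecided_at (P : prog) (q : cond) : Prop :=
  exists x, forall r c, cond_le r q -> ~ forces_lim P r x c.

Definition takes (P : prog) (x : nat) (c : bool) (N : nat) (q : cond) : Prop :=
  exists y, N <= y /\ x < y /\ comp P q x y c.

Definition dead (U : (nat -> Prop) -> Prop) (P : prog) (c : bool) (q : cond) : Prop :=
  exists S, U S /\ forall r x, cond_le r q -> S x -> ~ forces_lim P r x c.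

Definition extendible (U : (nat -> Prop) -> Prop) (P : prog) (c : bool) (k : constraint) (q : cond) : Prop :=
  exists x, bound (snd k) <= x /\ avoids U (fst k) (add false x (snd k)) /\ forces_lim P q x c.

Definition succeeds (U : (nat -> Prop) -> Prop) (P : prog) (al : bool -> bool)
    (D : bool -> prog * constraint) (q : cond) : Prop :=
  exists c t, al c = true /\
    success U P (fst (D c)) (avoids U (fst (snd (D c)))) (snd (snd (D c))) c q t.

(** Pairs replace functions on [bool] so that the requirements have a countable index type. *)
Definition cases {T : Type} (t : T * T) (c : bool) : T := if c then snd t else fst t.

(** One countable sum type indexes all requirements, so a single [f] serves every reduction [P]. *)
Lemma fully_generic_exists U : exists f : coloring, stable f /\
  (forall N, exists q, meets f q /\ N <= len q) /\
  (forall P, decides f (partial_at P)) /\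
  (forall P, decides f (undecided_at P)) /\
  (forall P x c N, decides f (takes P x c N)) /\
  (forall P c, decides f (dead U P c)) /\
  (forall P c k, decides f (extendible U P c k)) /\
  (forall P al D, decides f (succeeds U P al D)).
Proof.
assert (HK : countable constraint)
  by repeat (apply countable_prod || apply countable_list || apply countable_nat
    || apply countable_bool || apply countable_prog).
destruct (generic_exists
  (prog + (prog + (prog * (nat * (bool * nat)) + (prog * bool + (prog * (bool * constraint) +
     prog * ((bool * bool) * ((prog * constraint) * (prog * constraint))))))))
  (fun i => match i with
   | inl P => partial_at P
   | inr (inl P) => undecided_at P
   | inr (inr (inl (P, (x, (c, N))))) => takes P x c N
   | inr (inr (inr (inl (P, c)))) => dead U P c
   | inr (inr (inr (inr (inl (P, (c, k)))))) => extendible U P c k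
   | inr (inr (inr (inr (inr (P, (al, D)))))) => succeeds U P (cases al) (cases D)
   end)) as [f [Hf [Hu Hd]]].
{ repeat (exact HK || apply countable_sum || apply countable_prod || apply countable_nat
    || apply countable_bool || apply countable_prog). }
exists f; split; [exact Hf|split; [exact Hu|]].
split; [intros P; exact (Hd (inl P))|].
split; [intros P; exact (Hd (inr (inl P)))|].
split; [intros P x c N; exact (Hd (inr (inr (inl (P, (x, (c, N)))))))|].
split; [intros P c; exact (Hd (inr (inr (inr (inl (P, c))))))|].
split; [intros P c k; exact (Hd (inr (inr (inr (inr (inl (P, (c, k))))))))|].
intros P al D.
replace al with (cases (al false, al true))
  by (apply functional_extensionality; intros []; reflexivity).
replace D with (cases (D false, D true))
  by (apply functional_extensionality; intros []; reflexivity).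
exact (Hd (inr (inr (inr (inr (inr (P, ((al false, al true), (D false, D true)))))))) ).
Qed.

(** * A solution for one coloring computed from the generic one *)

Section Solution.

Variable U : (nat -> Prop) -> Prop.
Hypothesis HU : ultrafilter U.
Variable f : coloring.
Hypothesis f_long : forall N, exists q, meets f q /\ N <= len q.
Variables (f' : coloring) (P : prog).
Hypothesis f'_stable : stable f'.
Hypothesis f'_comp : forall n, eval (code f) P [n] (if code f' n then 1 else 0).
Hypothesis gen_partial : decides f (partial_at P).
Hypothesis gen_undecided : decides f (undecided_at P).
Hypothesis gen_takes : forall x c N, decides f (takes P x c N).
Hypothesis gen_dead : forall c, decides f (dead U P c).
Hypothesis gen_extendible : forall c k, decides f (extendible U P c k).
Hypothesis gen_succeeds : forall al D, decides f (succeeds U P al D).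

Lemma eval_f' x y : x < y ->
  eval (code f) P [Cantor.to_nat (x, y)] (if f' x y then 1 else 0).
Proof.
intros Hxy; pose proof (f'_comp (Cantor.to_nat (x, y))) as H; unfold code at 2 in H.
rewrite Cantor.cancel_of_to in H; apply Nat.ltb_lt in Hxy; now rewrite Hxy in H.
Qed.

Lemma comp_f' q x y c : meets f q -> x < y -> comp P q x y c -> f' x y = c.
Proof.
intros Hq Hxy Hc.
pose proof (eval_det _ _ _ _ (eval_f' x y Hxy) _ (comp_meets _ _ _ _ _ _ Hc Hq)) as E.
destruct (f' x y), c; auto; discriminate.
Qed.

Lemma f'_comp_met x y : x < y -> exists q, meets f q /\ comp P q x y (f' x y).
Proof. intros Hxy; apply comp_of_eval; [exact f_long|apply eval_f', Hxy]. Qed.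

Lemma meets_common q r : meets f q -> meets f r -> exists s, meets f s /\ cond_le s q /\ cond_le s r.
Proof.
intros Hq Hr; destruct (Nat.le_ge_cases (len q) (len r)) as [H|H].
- exists r; split; [auto|split; [apply (meets_comparable f); auto|apply cond_le_refl]].
- exists q; split; [auto|split; [apply cond_le_refl|apply (meets_comparable f); auto]].
Qed.

Lemma lim_f' q x c y : meets f q -> forces_lim P q x c -> len q <= y -> x < y -> f' x y = c.
Proof.
intros Hq Hl Hy Hxy; destruct (f'_comp_met x y Hxy) as [r [Hr Hc]].
destruct (meets_common q r Hq Hr) as [s [Hs [Hsq Hsr]]].
destruct (bool_dec (f' x y) c) as [|Hne]; auto.
exfalso; apply (Hl s y Hsq Hy Hxy); eapply comp_le; eauto.
replace (negb c) with (f' x y) by (destruct (f' x y), c; simpl; congruence); auto.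
Qed.

(** From some [N] on [f'] never takes the value [negb c] at [x], so by genericity a condition met by
    [f] excludes it; that condition is lengthened past [N]. *)
Lemma f'_lim_forced x : exists q c, meets f q /\ forces_lim P q x c.
Proof.
destruct (f'_stable x) as [c [N HN]].
destruct (gen_takes x (negb c) N) as [q [Hq [[y [Hy [Hxy Hc]]]|Hn]]].
- apply (comp_f' q x y) in Hc; auto.
  rewrite HN in Hc by auto; destruct c; discriminate.
- destruct (f_long N) as [r [Hr HrN]].
  destruct (meets_common q r Hq Hr) as [s [Hs [Hsq Hsr]]].
  exists s, c; split; auto.
  intros t y Ht Hy Hxy Hc; apply (Hn t).
  + eapply cond_le_trans; eauto.
  + exists y; split; [destruct Hsr; lia|auto].
Qed.

Definition alive (c : bool) : Prop := ~ exists q, meets f q /\ dead U P c q.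

(** What the game needs of its starting condition. *)
Definition base (p : cond) : Prop :=
  (forall q, cond_le q p -> ~ partial_at P q) /\
  (forall q, cond_le q p -> ~ undecided_at P q) /\
  (forall c, alive c -> forall q, cond_le q p -> ~ dead U P c q) /\
  (forall c, ~ alive c -> dead U P c p).

Lemma dead_le c q r : cond_le r q -> dead U P c q -> dead U P c r.
Proof.
intros Hr [S [HS H]]; exists S; split; auto.
intros s x Hs; apply H; eapply cond_le_trans; eauto.
Qed.

Lemma base_le p q : cond_le q p -> base p -> base q.
Proof.
intros Hq [H1 [H2 [H3 H4]]]; split; [|split; [|split]].
- intros r Hr; apply H1; eapply cond_le_trans; eauto.
- intros r Hr; apply H2; eapply cond_le_trans; eauto.
- intros c Hc r Hr; apply H3; auto; eapply cond_le_trans; eauto.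
- intros c Hc; eapply dead_le; eauto.
Qed.

Lemma base_exists : exists p, meets f p /\ base p.
Proof.
destruct gen_partial as [q1 [Hq1 [[x [y [Hxy H]]]|H1]]].
{ destruct (f'_comp_met x y Hxy) as [r [Hr Hc]].
  destruct (meets_common q1 r Hq1 Hr) as [s [Hs [Hsq Hsr]]].
  exact (False_ind _ (H s _ Hsq (comp_le _ _ _ _ _ _ Hsr Hc))). }
destruct gen_undecided as [q2 [Hq2 [[x H]|H2]]].
{ destruct (f'_lim_forced x) as [r [c [Hr Hc]]].
  destruct (meets_common q2 r Hq2 Hr) as [s [Hs [Hsq Hsr]]].
  exfalso; apply (H s c Hsq); eapply forces_lim_le; eauto. }
assert (H3 : forall c, exists q, meets f q /\
  (alive c -> forall r, cond_le r q -> ~ dead U P c r) /\ (~ alive c -> dead U P c q)).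
{ intros c; destruct (gen_dead c) as [q [Hq [H|H]]]; exists q; split; auto; split; auto.
  - intros Ha; exfalso; apply Ha; eauto.
  - intros Ha; apply NNPP in Ha as [r [Hr Hd]].
    destruct (meets_common q r Hq Hr) as [s [Hs [Hsq Hsr]]].
    exfalso; apply (H s Hsq); eapply dead_le; eauto. }
destruct (H3 false) as [q3 [Hq3 [H3a H3b]]], (H3 true) as [q4 [Hq4 [H4a H4b]]].
destruct (meets_common q1 q2 Hq1 Hq2) as [r1 [Hr1 [? ?]]].
destruct (meets_common q3 q4 Hq3 Hq4) as [r2 [Hr2 [? ?]]].
destruct (meets_common r1 r2 Hr1 Hr2) as [p [Hp [? ?]]].
assert (L1 : cond_le p q1) by eauto using cond_le_trans.
assert (L2 : cond_le p q2) by eauto using cond_le_trans.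
assert (L3 : cond_le p q3) by eauto using cond_le_trans.
assert (L4 : cond_le p q4) by eauto using cond_le_trans.
exists p; split; auto; split; [|split; [|split]].
- intros q Hq; apply H1; exact (cond_le_trans _ _ _ Hq L1).
- intros q Hq Hu; exact (H2 q (cond_le_trans _ _ _ Hq L2) Hu).
- intros [] Hc q Hq; [apply H4a|apply H3a]; auto; eapply cond_le_trans; eauto.
- intros [] Hc; [exact (dead_le _ _ _ L4 (H4b Hc))|exact (dead_le _ _ _ L3 (H3b Hc))].
Qed.

Lemma not_partial p : base p -> forall q x y, cond_le q p -> x < y ->
  exists r c, cond_le r q /\ comp P r x y c.
Proof.
intros [H _] q x y Hq Hxy; apply NNPP; intros Hn.
apply (H q Hq); exists x, y; split; auto; intros r c Hr Hc; apply Hn; eauto.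
Qed.

Lemma not_undecided p : base p -> forall q x, cond_le q p -> exists r c, cond_le r q /\ forces_lim P r x c.
Proof.
intros [_ [H _]] q x Hq; apply NNPP; intros Hn.
apply (H q Hq); exists x; intros r c Hr Hc; apply Hn; eauto.
Qed.

Lemma not_dead p : base p -> forall c, alive c -> forall q S, cond_le q p -> U S ->
  exists r x, cond_le r q /\ S x /\ forces_lim P r x c.
Proof.
intros [_ [_ [H _]]] c Hc q S Hq HS; apply NNPP; intros Hn.
apply (H c Hc q Hq); exists S; split; auto; intros r x Hr Hx Hl; apply Hn; eauto.
Qed.

(** If both colors were dead, a number in both witnessing large sets could never have its limit
    decided. *)
Lemma alive_exists : exists c, alive c.
Proof.
apply NNPP; intros Hn; destruct base_exists as [p [_ Hb]].
assert (Hd : forall c, dead U P c p) by (intros c; apply Hb; eauto).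
destruct (Hd false) as [S0 [HS0 H0]], (Hd true) as [S1 [HS1 H1]].
destruct (uf_ex _ HU _ (uf_and _ HU _ _ HS0 HS1)) as [x [Hx0 Hx1]].
destruct (not_undecided p Hb p x (cond_le_refl p)) as [r [[] [Hr Hl]]].
- exact (H1 r x Hr Hx1 Hl).
- exact (H0 r x Hr Hx0 Hl).
Qed.

Definition valid (c : bool) (k : constraint) : Prop :=
  avoids U (fst k) (snd k) /\ exists q, meets f q /\ sound P c q (snd k).

(** Otherwise each alive color has some [G] and constraint that it cannot defeat; the game is played
    with these as the two opponents. *)
Lemma winner_exists : exists c, alive c /\ forall G k, valid c k ->
  exists q t, meets f q /\ success U P G (avoids U (fst k)) (snd k) c q t.
Proof.
apply NNPP; intros Hn; destruct base_exists as [p [Hp Hb]].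
assert (HD : forall c, exists D : prog * constraint, valid c (snd D) /\
   (alive c -> forall q t, meets f q ->
     ~ success U P (fst D) (avoids U (fst (snd D))) (snd (snd D)) c q t)).
{ intros c; destruct (classic (alive c)) as [Ha|Ha].
  - apply NNPP; intros HD; apply Hn; exists c; split; auto; intros G k Hk.
    apply NNPP; intros Hs; apply HD; exists (G, k); split; auto.
    intros _ q t Hq Ht; apply Hs; eauto.
  (* A dead color receives a dummy program and the empty constraint. *)
  - exists (PZero, ([], (0, ([], [])))); split; [|contradiction].
    split; [intros ? ? ? []|exists p; split; auto].
    split; [intros [] ? []|split; [intros ? []|intros ? ? []]]. }
destruct (HD false) as [D0 [[Hav0 [q0 [Hq0 Hs0]]] HD0]], (HD true) as [D1 [[Hav1 [q1 [Hq1 Hs1]]] HD1]].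
assert (Hal : forall c, exists b : bool, b = true <-> alive c).
{ intros c; destruct (classic (alive c)); [exists true|exists false]; intuition discriminate. }
destruct (Hal false) as [a0 Ha0], (Hal true) as [a1 Ha1].
(* A success is either met by [f], against the choice of [D0] and [D1], or excluded below [q],
   against [some_success] applied at [r]. *)
destruct (gen_succeeds (cases (a0, a1)) (cases (D0, D1))) as [q [Hq [[c [t [Hc Ht]]]|Hav]]].
{ destruct c; simpl in *; [eapply HD1|eapply HD0]; eauto; tauto. }
destruct (meets_common q p Hq Hp) as [r1 [Hr1 [? ?]]].
destruct (meets_common q0 q1 Hq0 Hq1) as [r2 [Hr2 [? ?]]].
destruct (meets_common r1 r2 Hr1 Hr2) as [r [Hr [? ?]]].
assert (Hbr : base r) by (eapply base_le; [|exact Hb]; eauto using cond_le_trans).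
destruct alive_exists as [c0 Hc0].
assert (Hst : forall d, sound P d r (snd (snd (cases (D0, D1) d))) /\
  avoids U (fst (snd (cases (D0, D1) d))) (snd (snd (cases (D0, D1) d)))).
{ assert (L0 : cond_le r q0) by eauto using cond_le_trans.
  assert (L1 : cond_le r q1) by eauto using cond_le_trans.
  intros []; split; auto; [exact (sound_le _ _ _ _ _ L1 Hs1)|exact (sound_le _ _ _ _ _ L0 Hs0)]. }
destruct (some_success U HU P r (not_partial r Hbr) (not_undecided r Hbr) alive
  (not_dead r Hbr) (proj2 (proj2 (proj2 Hbr)))
  (fun c => fst (cases (D0, D1) c)) (fun c => avoids U (fst (snd (cases (D0, D1) c))))
  (fun c => snd (snd (cases (D0, D1) c)))
  (fun c j s => avoids_add U _ j s HU) c0 Hc0 Hst) as [c [s [t [Hc [Hs Ht]]]]].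
apply (Hav s); [eauto using cond_le_trans|].
exists c, t; split; auto; destruct c; simpl; tauto.
Qed.

Definition diagonalized (G : prog) (k : constraint) : Prop :=
  (exists i n, In (G, (i, n)) (fst k)) \/
  exists q u v, meets f q /\ bad_pair q u v /\
    outputs G (snd k) false u /\ outputs G (snd k) true v.

Definition refines (k' k : constraint) : Prop :=
  extends (snd k') (snd k) /\ incl (fst k) (fst k').

Lemma refines_trans k1 k2 k3 : refines k1 k2 -> refines k2 k3 -> refines k1 k3.
Proof.
intros [H1 H2] [H3 H4]; split; [eapply extends_trans; eauto|eapply incl_tran; eauto].
Qed.

Lemma diagonalized_refines G k' k : refines k' k -> diagonalized G k -> diagonalized G k'.
Proof.
intros [H1 H2] [[i [n H]]|[q [u [v [Hq [Hb [Hu Hv]]]]]]].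
- left; eauto.
- right; exists q, u, v; split; [auto|split; [auto|]].
  split; eapply outputs_extends; eauto.
Qed.

(** [not_dead] alone gives a condition that [f] might not meet; genericity for [extendible]
    transfers the new point to [f]. *)
Lemma extend_left c k : alive c -> valid c k -> exists x,
  valid c (fst k, add false x (snd k)) /\ bound (snd k) <= x.
Proof.
destruct k as [L s]; intros Hc [Hav [q [Hq Hs]]]; simpl in *.
destruct base_exists as [p [Hp Hb]].
destruct (gen_extendible c (L, s)) as [r [Hr [[x [Hx [Hax Hl]]]|Hn]]]; simpl in *.
- destruct (meets_common q r Hq Hr) as [t [Ht [Htq Htr]]].
  exists x; split; auto; split; simpl; auto.
  exists t; split; auto; apply sound_add_left; auto.
  + exact (sound_le _ _ _ _ _ Htq Hs).
  + exact (forces_lim_le _ _ _ _ _ Htr Hl).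
- destruct (meets_common r p Hr Hp) as [t [Ht [Htr Htp]]].
  destruct (not_dead p Hb c Hc t _ Htp (uf_and _ HU _ _ (avoids_add U L false s HU Hav)
    (uf_ge _ HU (bound s)))) as [t' [x [Ht' [[Hax Hx] Hl]]]].
  exfalso; apply (Hn t'); [eapply cond_le_trans; eauto|].
  exists x; auto.
Qed.

Lemma comp_all c y l : (forall x, In x l -> x < y -> f' x y = c) ->
  exists q, meets f q /\ forall x, In x l -> x < y -> comp P q x y c.
Proof.
induction l as [|x l IH]; intros Hl.
- destruct (f_long 0) as [q [Hq _]]; exists q; split; auto; intros x [].
- destruct IH as [q [Hq Hql]]; [intros; apply Hl; auto; now right|].
  destruct (Nat.lt_ge_cases x y) as [Hxy|Hxy].
  + destruct (f'_comp_met x y Hxy) as [r [Hr Hrx]].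
    rewrite (Hl x) in Hrx by (auto; now left).
    destruct (meets_common q r Hq Hr) as [s [Hs [Hsq Hsr]]].
    exists s; split; auto; intros z [<-|Hz] Hzy;
      [exact (comp_le _ _ _ _ _ _ Hsr Hrx)|exact (comp_le _ _ _ _ _ _ Hsq (Hql z Hz Hzy))].
  + exists q; split; auto; intros z [<-|Hz] Hzy; [lia|auto].
Qed.

Lemma extend_right c k : valid c k -> exists y,
  valid c (fst k, add true y (snd k)) /\ bound (snd k) <= y.
Proof.
destruct k as [L s]; intros [Hav [q [Hq Hs]]]; simpl in *.
destruct (uf_ex _ HU _ (uf_and _ HU _ _ (avoids_add U L true s HU Hav)
  (uf_ge _ HU (bound s + len q)))) as [y [Hay Hy]].
pose proof Hs as [Hw [Hl Hc]].
destruct (comp_all c y (part false s)) as [r [Hr Hrc]].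
{ intros x Hx Hxy; eapply lim_f'; eauto; lia. }
destruct (meets_common q r Hq Hr) as [t [Ht [Htq Htr]]].
exists y; split; [|lia]; split; simpl; auto.
exists t; split; auto; split; [apply wf_add; auto; lia|split].
- intros x Hx; apply in_add in Hx as [[? _]|Hx]; [discriminate|].
  exact (forces_lim_le _ _ _ _ _ Htq (Hl x Hx)).
- intros x z Hx Hz Hxz; apply in_add in Hx as [[? _]|Hx]; [discriminate|].
  apply in_add in Hz as [[_ ->]|Hz].
  + exact (comp_le _ _ _ _ _ _ Htr (Hrc x Hx Hxz)).
  + exact (comp_le _ _ _ _ _ _ Htq (Hc x z Hx Hz Hxz)).
Qed.

Lemma diagonalize c G k : (forall k, valid c k ->
    exists q t, meets f q /\ success U P G (avoids U (fst k)) (snd k) c q t) ->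
  valid c k -> exists k', valid c k' /\ refines k' k /\ diagonalized G k'.
Proof.
intros Hw Hk; destruct k as [L s]; destruct (Hw _ Hk) as [q [t [Hq [Hso [He [Hav Hd]]]]]].
simpl in *; destruct Hd as [[i [n Hd]]|[u [v [Hb [Hu Hv]]]]].
- exists ((G, (i, n)) :: L, t); split; [|split].
  + split; [|exists q; auto].
    intros g j m [E|H]; [injection E as <- <- <-; exact Hd|apply Hav; exact H].
  + split; auto; intros a Ha; now right.
  + left; exists i, n; now left.
- exists (L, t); split; [|split].
  + split; eauto.
  + split; auto; apply incl_refl.
  + right; exists q, u, v; auto.
Qed.

Lemma solution_step c n k : alive c -> (forall G k, valid c k ->
    exists q t, meets f q /\ success U P G (avoids U (fst k)) (snd k) c q t) ->
  valid c k -> exists k', valid c k' /\ refines k' k /\ S (bound (snd k)) <= bound (snd k') /\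
    (forall i, exists x, bound (snd k) <= x /\ In x (part i (snd k'))) /\
    forall G, prog_code G = n -> diagonalized G k'.
Proof.
intros Hc Hw Hk.
assert (H1 : exists k1, valid c k1 /\ refines k1 k /\
  forall G, prog_code G = n -> diagonalized G k1).
{ destruct (classic (exists G, prog_code G = n)) as [[G HG]|Hn].
  - destruct (diagonalize c G k (Hw G) Hk) as [k1 [H1 [H2 H3]]].
    exists k1; split; [auto|split; [auto|]].
    intros G' HG'; replace G' with G by (apply prog_code_inj; congruence); auto.
  - exists k; split; [auto|split; [split; [apply extends_refl|apply incl_refl]|]].
    intros G HG; exfalso; eauto. }
destruct H1 as [k1 [Hk1 [Hr1 Hd1]]].
destruct (extend_left c k1 Hc Hk1) as [x [Hk2 Hx]].
destruct (extend_right c _ Hk2) as [y [Hk3 Hy]]; simpl in *.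
pose proof Hr1 as [[Hb1 _] _].
exists (fst k1, add true y (add false x (snd k1))).
assert (Hr3 : refines (fst k1, add true y (add false x (snd k1))) k1).
{ split; simpl; [|apply incl_refl].
  eapply extends_trans; apply extends_add; simpl; auto. }
split; [auto|split; [eapply refines_trans; eauto|split; [simpl in *; lia|split]]].
- intros []; simpl; [exists y|exists x]; simpl in *; split; auto; lia.
- intros G HG; eapply diagonalized_refines; eauto.
Qed.

Definition mem (x : nat) (l : list nat) : bool := if in_dec Nat.eq_dec x l then true else false.

Lemma mem_spec x l : mem x l = true <-> In x l.
Proof. unfold mem; destruct (in_dec Nat.eq_dec x l); intuition discriminate. Qed.

Lemma half_elt i H x : half i H x = H (elt i x).
Proof. destruct i; reflexivity. Qed.

Lemma elt_cases n : exists i x, n = elt i x /\ x <= n.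
Proof.
destruct (Nat.Even_or_Odd n) as [[x Hx]|[x Hx]]; [exists false, x|exists true, x];
  simpl; lia.
Qed.

Theorem solution_exists : exists H, inc_p_homogeneous f' H /\
  forall K, computable_from H K -> ~ p_homogeneous f K.
Proof.
destruct winner_exists as [c [Hc Hw]].
(* Validity is assumed inside the existential so that [next] is total. *)
assert (Hstep : forall n k, exists k', valid c k -> valid c k' /\ refines k' k /\
    S (bound (snd k)) <= bound (snd k') /\
    (forall i, exists x, bound (snd k) <= x /\ In x (part i (snd k'))) /\
    forall G, prog_code G = n -> diagonalized G k').
{ intros n k; destruct (classic (valid c k)) as [Hk|Hk]; [|exists k; contradiction].
  destruct (solution_step c n k Hc Hw Hk) as [k' Hk']; exists k'; auto. }
set (next := fun n k => proj1_sig (constructive_indefinite_description _ (Hstep n k))).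
set (K := fix K n := match n with
  0 => (([], (0, ([], []))) : constraint) | S n => next n (K n) end).
assert (Hnext : forall n, valid c (K n) -> valid c (K (S n)) /\ refines (K (S n)) (K n) /\
    S (bound (snd (K n))) <= bound (snd (K (S n))) /\
    (forall i, exists x, bound (snd (K n)) <= x /\ In x (part i (snd (K (S n))))) /\
    forall G, prog_code G = n -> diagonalized G (K (S n))).
{ intros n; exact (proj2_sig (constructive_indefinite_description _ (Hstep n (K n)))). }
assert (HK : forall n, valid c (K n)).
{ induction n; [|apply Hnext; auto].
  split; [intros ? ? ? []|destruct (f_long 0) as [q [Hq _]]; exists q; split; auto].
  split; [intros [] ? []|split; [intros ? []|intros ? ? []]]. }
assert (Hmono : forall m n, m <= n -> refines (K n) (K m)).
{ intros m n H; induction H; [split; [apply extends_refl|apply incl_refl]|].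
  eapply refines_trans; [apply Hnext; auto|auto]. }
assert (Hbound : forall n, n <= bound (snd (K n))).
{ induction n; [lia|]; destruct (Hnext n (HK n)) as [_ [_ [? _]]]; lia. }
clearbody K; clear next Hstep.
(* At stage [S x] the bound exceeds [x], so membership of [x] is final. *)
set (H := fun n => mem (Nat.div2 n) (part (Nat.odd n) (snd (K (S (Nat.div2 n)))))).
assert (Hhalf : forall i x, half i H x = mem x (part i (snd (K (S x))))).
{ intros i x; rewrite half_elt; unfold H.
  assert (E : Nat.div2 (elt i x) = x /\ Nat.odd (elt i x) = i).
  { destruct i; simpl elt; split.
    - rewrite Nat.add_1_r; apply Nat.div2_succ_double.
    - rewrite Nat.add_1_r, Nat.odd_succ; apply Nat.even_even.
    - apply Nat.div2_double.
    - apply Nat.odd_even. }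
  destruct E as [-> ->]; reflexivity. }
assert (Hag : forall n, agrees H (snd (K n))).
{ intros n i x Hx; rewrite Hhalf, mem_spec.
  pose proof (Hbound (S x)).
  destruct (Nat.le_ge_cases n (S x)) as [Hn|Hn]; destruct (Hmono _ _ Hn) as [[_ E] _].
  - apply E; exact Hx.
  - symmetry; apply E; lia. }
clearbody H.
assert (Hin : forall i n x, In x (part i (snd (K n))) -> half i H x = true).
{ intros i n x Hx; apply (Hag n); auto.
  destruct (HK n) as [_ [q [_ [Hwf _]]]]; eapply Hwf; eauto. }
assert (Hinf : forall i, infinite (half i H)).
{ intros i n; destruct (Hnext n (HK n)) as [_ [_ [_ [Hi _]]]].
  destruct (Hi i) as [x [Hx1 Hx2]]; exists x; split; [|eauto].
  specialize (Hbound n); lia. }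
exists H; split.
- split; [exact (Hinf false)|split; [exact (Hinf true)|]].
  exists c; intros x y Hx Hy Hxy.
  pose proof (Hbound (S y)).
  apply (Hag (S y) false) in Hx; [|lia]; apply (Hag (S y) true) in Hy; [|lia].
  destruct (HK (S y)) as [_ [q [Hq [_ [_ Hcomp]]]]].
  eapply comp_f'; eauto.
- intros A [G HG] [HL [HR [e He]]].
  assert (Hdec : forall i u n, outputs G (snd (K n)) i u -> half i A u = true).
  { intros i u n Ho; pose proof (eval_det _ _ _ _ (Ho H (Hag n)) _ (HG (elt i u))) as E.
    rewrite half_elt; destruct (A (elt i u)); auto; discriminate. }
  destruct (Hnext (prog_code G) (HK _)) as [_ [_ [_ [_ Hd]]]].
  destruct (Hd G eq_refl) as [[i [n Hn]]|[q [u [v [Hq [[Huv [Hv Hb]] [Hu Hv']]]]]]].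
  + assert (Hi : infinite (half i A)) by (destruct i; assumption).
    destruct (Hi n) as [u [Hnu HAu]].
    pose proof (HG (elt i u)) as Heu; rewrite <- half_elt, HAu in Heu.
    destruct (eval_use _ _ _ _ Heu) as [N HN].
    (* Stage [j] fixes the whole use of the output [u] and comes after the commitment to avoid
       it. *)
    set (j := Nat.max N (S (prog_code G))).
    destruct (HK j) as [Hav _].
    destruct (Hmono (S (prog_code G)) j ltac:(unfold j; lia)) as [_ Hincl].
    apply (Hav G i n (Hincl _ Hn)); apply unavoidable_now; exists u; split; auto.
    intros H' HH'; apply HN; intros m Hm.
    destruct (elt_cases m) as [i' [x [-> Hx]]].
    assert (Hxj : x < bound (snd (K j))) by (specialize (Hbound j); lia).
    specialize (Hag j i' x Hxj); specialize (HH' i' x Hxj); rewrite !half_elt in *.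
    destruct (H (elt i' x)), (H' (elt i' x)); intuition congruence.
  + pose proof (Hdec false u _ Hu) as HAu; pose proof (Hdec true v _ Hv') as HAv.
    (* A large [y] on the right shows the lock of [u], a large [x] on the left that of [v]; the
       latter pair is decreasing, so full p-homogeneity is used. *)
    destruct (HR (len q + u + 1)) as [y [Hy HAy]], (HL (len q + v + 1)) as [x [Hx HAx]].
    pose proof (He u v HAu HAv ltac:(lia)) as E1.
    pose proof (He u y HAu HAy ltac:(lia)) as E2.
    pose proof (He x v HAx HAv ltac:(lia)) as E3.
    unfold colpair in *.
    rewrite Nat.min_l, Nat.max_r in E1 by lia.
    rewrite Nat.min_l, Nat.max_r in E2 by lia.
    rewrite Nat.min_r, Nat.max_l in E3 by lia.
    rewrite Hq, Nat.min_l in E1 by lia.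
    rewrite Hq, Nat.min_r in E2 by lia.
    rewrite Hq, Nat.min_r in E3 by lia.
    fold (lock q u) in E2; fold (lock q v) in E3.
    destruct Hb as [Hb|Hb]; apply Hb; congruence.
Qed.

End Solution.

Theorem theorem4p1 :
  exists (f : coloring) (Y : set -> Prop),
    stable f /\
    (forall P, Y P -> infinite P) /\
    (forall P, Y P ->
       forall H, computable_from (join (code f) P) H -> ~ p_homogeneous f H) /\
    (forall f' : coloring, stable f' -> Tred (code f') (code f) ->
       (exists P, Y P /\ exists H,
           computable_from (join (code f) P) H /\ inc_p_homogeneous f' H) \/
       (exists H, inc_p_homogeneous f' H /\
           forall G, computable_from H G -> ~ p_homogeneous f G)).
Proof.
destruct ultrafilter_exists as [U HU].
destruct (fully_generic_exists U) as [f [Hf [Hl [H1 [H2 [H3 [H4 [H5 H6]]]]]]]].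
exists f, (fun _ => False); split; [exact Hf|split; [tauto|split; [tauto|]]].
intros f' Hf' [P HP]; right.
apply (solution_exists U HU f Hl f' P); auto.
Qed.
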